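(* Let $C>0$ and let $Z$ be a $C$-Capon space. (i) For every $\eta>0$ and every non-principal ultrafilter $\mathcal U$ on $\mathbb N$, every bounded Haar multiplier $D:Z\to Z$ is a $C$-projectional factor of $\lambda_{\mathcal U}(D)\,\mathcal C+\mu_{\mathcal U}(D)(\mathrm{Id}-\mathcal C)$ with error $\eta$. (ii) If, additionally, the Capon projection $\mathcal C$ is unbounded on $Z$, then for every such $D$ and $\mathcal U$, $\lambda_{\mathcal U}(D)=\mu_{\mathcal U}(D)$ and, thus, for every $\eta>0$, $D$ is a $C$-projectional factor with error $\eta$ of $\lambda_{\mathcal U}(D)\,\mathrm{Id}$. If, in particular, $D:Z\to Z$ is a bounded Haar multiplier such that, for some non-principal ultrafilter $\mathcal U$ on $\mathbb N$, $(\lambda_{\mathcal U}(D),\mu_{\mathcal U}(D))\notin\{(1,0),(0,1)\}$, then the identity on $Z$ factors through $D$ or through $\mathrm{Id}-D$.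
   Context: Haar functions. $\mathcal D$ is the set of dyadic intervals in $[0,1)$, $\mathcal D_j=\{I\in\mathcal D:|I|=2^{-j}\}$, $j\ge0$. For $I\in\mathcal D$, $I^{+}=I^{+1}$ and $I^-=I^{-1}$ are its left and right halves, $h_I=\chi_{I^+}-\chi_{I^-}$; $(k_J)$ is a copy of $(h_I)$. $\mathcal V(\delta)=\mathrm{span}\{h_I\}$; $(h_I\otimes k_J)(s,t)=h_I(s)k_J(t)$; $\mathcal V(\delta^2)=\mathrm{span}\{h_I\otimes k_J\}$; $\langle f,g\rangle=\int_0^1\int_0^1fg\,ds\,dt$. A Haar multiplier is a linear operator $D$ with $D(h_I\otimes k_J)=d_{I,J}h_I\otimes k_J$, $d_{I,J}\in\mathbb R$, for all $I,J$. The Capon projection $\mathcal C$ is the Haar multiplier on $\mathcal V(\delta^2)$ with coefficient $1$ if $|I|\le|J|$ and $0$ if $|I|>|J|$. Functionals. For a Haar multiplier with bounded coefficients and a non-principal ultrafilter $\mathcal U$ on $\mathbb N$, $$\lambda_{\mathcal U}(D)=\lim_{j\to\mathcal U}\lim_{i\to\mathcal U}\sum_{I\in\mathcal D_i,J\in\mathcal D_j}|I||J|d_{I,J},\qquad \mu_{\mathcal U}(D)=\lim_{i\to\mathcal U}\lim_{j\to\mathcal U}\sum_{I\in\mathcal D_i,J\in\mathcal D_j}|I||J|d_{I,J}.$$ Bi-tree variation norm. With $\omega,\xi$ ranging over $\{\pm1\}$, $$\|D\|_{\mathrm T^2\mathrm S}=\sum_{k=0}^\infty(k+1)\max_{I,J\in\mathcal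 D_k,\,\omega,\xi}|d_{I,J}-d_{I^\omega,J^\xi}|+\sum_{k=0}^\infty(k+1)\max_{I\in\mathcal D_k,\,J\in\mathcal D_{k+1},\,\omega,\xi}|d_{I,J}-d_{I^\omega,J^\xi}|$$ $$\qquad+\sum_{i=0}^\infty\sum_{j=0}^i\max_{I\in\mathcal D_i,\,J\in\mathcal D_j,\,\omega}|d_{I,J}-d_{I^\omega,J}|+\sum_{j=0}^\infty\sum_{i=0}^j\max_{I\in\mathcal D_i,\,J\in\mathcal D_{j+1},\,\xi}|d_{I,J}-d_{I,J^\xi}|,$$ $$\|D\|_{\mathrm T^2}=\|D\|_{\mathrm T^2\mathrm S}+|d_{[0,1),[0,1)}|+|d_{[0,1),[0,1/2)}|+|d_{[0,1),[1/2,1)}|\in[0,\infty].$$ Faithful Haar systems. A family $(\tilde h_I)_{I\in\mathcal D}$ in $\mathcal V(\delta)$ is a faithful Haar system relative to the frequencies $(m_i)_{i=0}^\infty$ (strictly increasing in $\mathbb N_0$) if for each $i$ and $I\in\mathcal D_i$ there are a set $\mathcal A_I\subset\mathcal D_{m_i}$ and signs $\varepsilon_K=\pm1$ with $\tilde h_I=\sum_{K\in\mathcal A_I}\varepsilon_Kh_K$, and, with $\Gamma_I=\bigcup\mathcal A_I$, $\Gamma_{[0,1)}=[0,1)$, $\Gamma_{I^+}=\{\tilde h_I=1\}$, $\Gamma_{I^-}=\{\tilde h_I=-1\}$. For two such systems $\tilde H=(\tilde h_I)$, $\tilde K=(\tilde k_J)$ (relative to frequencies $(m_i)$ and $(n_j)$)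 define on $\mathcal V(\delta^2)$ $$A_{\tilde H\otimes\tilde K}f=\sum_{I,J}\frac{\langle\tilde h_I\otimes\tilde k_J,f\rangle}{|I||J|}h_I\otimes k_J,\qquad B_{\tilde H\otimes\tilde K}f=\sum_{I,J}\frac{\langle h_I\otimes k_J,f\rangle}{|I||J|}\tilde h_I\otimes\tilde k_J.$$ Capon spaces. Let $Z$ be the completion of $\mathcal V(\delta^2)$ under a norm $\|\cdot\|$; for linear $T$ defined on $\mathcal V(\delta^2)$ put $\|T\|_{\mathcal L(Z)}=\sup\{\|Tf\|:f\in\mathcal V(\delta^2),\|f\|\le1\}$. $Z$ is a $C$-Capon space if (a) $\|A_{\tilde H\otimes\tilde K}\|_{\mathcal L(Z)}\|B_{\tilde H\otimes\tilde K}\|_{\mathcal L(Z)}\le C$ for all faithful Haar systems $\tilde H,\tilde K$ relative to some frequencies; and (b) there is $\beta>0$ such that for every bounded Haar multiplier $D:Z\to Z$ and every non-principal ultrafilter $\mathcal U$ on $\mathbb N$, $\|D-(\lambda_{\mathcal U}(D)\mathcal C+\mu_{\mathcal U}(D)(\mathrm{Id}-\mathcal C))\|_{\mathcal L(Z)}\le\beta\|D\|_{\mathrm T^2}$. Factorization. For bounded $S,T$ on $Z$: $S$ factors through $T$ if $S=ATB$ for some bounded $A,B:Z\to Z$; $T$ is a $C$-projectional factor of $S$ with error $\eta$ if there are bounded $A,B:Z\to Z$ with $\|A\|\|B\|\le C$, $AB=\mathrm{Id}$, $\|S-ATB\|\le\eta$. *)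

(* Defs.v *)
From HB Require Import structures.
From mathcomp Require Import all_boot all_order all_algebra.
From mathcomp Require Import all_classical all_reals all_analysis.

Set Implicit Arguments.
Unset Strict Implicit.
Unset Printing Implicit Defensive.

Import Order.TTheory GRing.Theory Num.Theory.
Import numFieldNormedType.Exports.

Local Open Scope classical_set_scope.
Local Open Scope ring_scope.

Section Span.
Context {R : realType} {U : lmodType R} {T : Type}.
Variable e : T -> U.

Definition in_span : {pred U} := fun u =>
  `[< exists s : seq (R * T), u = \sum_(x <- s) x.1 *: e x.2 >].

Lemma in_span_submod : submod_closed in_span.
Proof.
split; first by apply/asboolP; exists [::]; rewrite big_nil.
move=> a _ _ /asboolP[s ->] /asboolP[t ->]; apply/asboolP.
exists ([seq (a * x.1, x.2) | x <- s] ++ t).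
rewrite big_cat big_map scaler_sumr /=.
by under [in RHS]eq_bigr do rewrite -scalerA.
Qed.

HB.instance Definition _ := GRing.isSubmodClosed.Build R U in_span in_span_submod.

Lemma mem_in_span x : e x \in in_span.
Proof. by apply/asboolP; exists [:: (1, x)]; rewrite big_seq1 scale1r. Qed.

Record span_of := SpanOf { span_val :> U ; _ : span_val \in in_span }.

HB.instance Definition _ := [isSub for span_val].
HB.instance Definition _ := [Choice of span_of by <:].
HB.instance Definition _ := [SubChoice_isSubLmodule of span_of by <:].

End Span.

(* [existT _ j k] stands for the dyadic interval [k 2^-j, (k+1) 2^-j), so that
   the fibre 'I_(2 ^ j) enumerates the dyadic intervals of length 2^-j. *)
Definition dyadic : Type := {j : nat & 'I_(2 ^ j)}.
HB.instance Definition _ := Choice.on dyadic.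
Definition dy (j : nat) (k : 'I_(2 ^ j)) : dyadic := existT _ j k.
Definition level (I : dyadic) : nat := projT1 I.

Lemma child_subproof (w : bool) (I : dyadic) :
  ((tagged I).*2 + ~~ w < 2 ^ (level I).+1)%N.
Proof.
case: I => j k /=; rewrite expnS mul2n.
have := ltn_ord k; rewrite -(leq_double k.+1) doubleS; case: w => /=; last first.
  by rewrite addn1.
by rewrite addn0 => /ltnW.
Qed.

(* [child true I] is the left half I^{+1}, [child false I] the right half I^{-1}. *)
Definition child (w : bool) (I : dyadic) : dyadic :=
  dy (Ordinal (child_subproof w I)).

Lemma expn2_gt0 j : (0 < 2 ^ j)%N. Proof. by rewrite expn_gt0. Qed.
Definition unit_itv : dyadic := @dy 0 (Ordinal (expn2_gt0 0)).

Section Haar.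
Context {R : realType}.

Definition dlen (I : dyadic) : R := 2 ^- level I.

Definition ditv (I : dyadic) : set R :=
  [set` `[(tagged I)%:R * dlen I, (tagged I).+1%:R * dlen I[ ].

(* Functions on [0,1) and [0,1)^2 are extended by 0 to R and R * R. *)
Definition haar_fun (I : dyadic) : R -> R^o :=
  \1_(ditv (child true I)) - \1_(ditv (child false I)).

Definition tensor_fun (f g : R -> R^o) : R * R -> R^o :=
  fun p => f p.1 * g p.2.

Definition V1 : Type := span_of haar_fun.

Definition V2 : Type :=
  span_of (fun IJ : dyadic * dyadic => tensor_fun (haar_fun IJ.1) (haar_fun IJ.2)).

Definition haar (I : dyadic) : V1 := SpanOf (mem_in_span haar_fun I).

Lemma tensor_subproof (f g : V1) : tensor_fun (\val f) (\val g) \in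
  in_span (fun IJ : dyadic * dyadic => tensor_fun (haar_fun IJ.1) (haar_fun IJ.2)).
Proof.
case: f g => f /= /asboolP[s ->] [g /= /asboolP[t ->]].
have -> : tensor_fun (\sum_(x <- s) x.1 *: haar_fun x.2)
    (\sum_(y <- t) y.1 *: haar_fun y.2) =
  \sum_(x <- s) \sum_(y <- t)
    (x.1 * y.1) *: tensor_fun (haar_fun x.2) (haar_fun y.2).
  apply/funext => p; rewrite /tensor_fun !fct_sumE mulr_suml.
  apply: eq_bigr => x _; rewrite fct_sumE mulr_sumr; apply: eq_bigr => y _.
  by rewrite !scalrfctE /= mulrACA.
apply: rpred_sum => x _; apply: rpred_sum => y _; apply: rpredZ.
exact: (mem_in_span _ (x.2, y.2)).
Qed.

Definition tensor (f g : V1) : V2 := SpanOf (tensor_subproof f g).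

Definition haar2 (I J : dyadic) : V2 := tensor (haar I) (haar J).

Definition ip (f g : V2) : R :=
  (\int[lebesgue_measure]_(t in `[0%R, 1%R])
    (\int[lebesgue_measure]_(s in `[0%R, 1%R])
      ((\val f : R * R -> R) (s, t) * (\val g : R * R -> R) (s, t))))%R.

(* Since ip (haar2 I J) (haar2 K L) is dlen I * dlen J if (I, J) = (K, L) and 0
   otherwise, this is the linear operator on V2 mapping haar2 I J to
   d I J *: haar2 I J.  Here and in opA, opB below, only finitely many terms of
   the sum are nonzero. *)
Definition haar_mult (d : dyadic -> dyadic -> R) (f : V2) : V2 :=
  \sum_(IJ \in [set: dyadic * dyadic])
    (d IJ.1 IJ.2 * (ip (haar2 IJ.1 IJ.2) f / (dlen IJ.1 * dlen IJ.2)))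
      *: haar2 IJ.1 IJ.2.

Definition capon : V2 -> V2 :=
  haar_mult (fun I J => if dlen I <= dlen J then 1 else 0).

Definition level_sum (d : dyadic -> dyadic -> R) (i j : nat) : R :=
  \sum_(I < 2 ^ i) \sum_(J < 2 ^ j)
    dlen (dy I) * dlen (dy J) * d (dy I) (dy J).

Definition lambdaU (U : set_system nat) (d : dyadic -> dyadic -> R) : R :=
  lim ((fun j => lim ((fun i => level_sum d i j) @ U)) @ U).

Definition muU (U : set_system nat) (d : dyadic -> dyadic -> R) : R :=
  lim ((fun i => lim ((fun j => level_sum d i j) @ U)) @ U).

(* The maxima below are over finite nonempty sets of nonnegative reals, so
   starting them at 0 is harmless. *)
Definition var2 (d : dyadic -> dyadic -> R) (i j : nat) : R :=
  \big[Num.max/0]_(I < 2 ^ i) \big[Num.max/0]_(J < 2 ^ j)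
    \big[Num.max/0]_(w : bool) \big[Num.max/0]_(x : bool)
      `|d (dy I) (dy J) - d (child w (dy I)) (child x (dy J))|.

Definition varl (d : dyadic -> dyadic -> R) (i j : nat) : R :=
  \big[Num.max/0]_(I < 2 ^ i) \big[Num.max/0]_(J < 2 ^ j)
    \big[Num.max/0]_(w : bool)
      `|d (dy I) (dy J) - d (child w (dy I)) (dy J)|.

Definition varr (d : dyadic -> dyadic -> R) (i j : nat) : R :=
  \big[Num.max/0]_(I < 2 ^ i) \big[Num.max/0]_(J < 2 ^ j)
    \big[Num.max/0]_(x : bool)
      `|d (dy I) (dy J) - d (dy I) (child x (dy J))|.

Definition T2S_norm (d : dyadic -> dyadic -> R) : \bar R :=
  (\sum_(0 <= k <oo) (k.+1%:R * var2 d k k)%:E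
   + \sum_(0 <= k <oo) (k.+1%:R * var2 d k k.+1)%:E
   + \sum_(0 <= i <oo) (\sum_(0 <= j < i.+1) varl d i j)%:E
   + \sum_(0 <= j <oo) (\sum_(0 <= i < j.+1) varr d i j.+1)%:E)%E.

Definition T2_norm (d : dyadic -> dyadic -> R) : \bar R :=
  (T2S_norm d + (`|d unit_itv unit_itv|
    + `|d unit_itv (child true unit_itv)|
    + `|d unit_itv (child false unit_itv)|)%:E)%E.

Definition Gam (m : nat) (A : {set 'I_(2 ^ m)}) : set R :=
  \bigcup_(K in [set` A]) ditv (dy K).

Definition faithful_haar (m : nat -> nat) (ht : dyadic -> V1) : Prop :=
  {homo m : i j / (i < j)%N} /\
  exists (A : forall I : dyadic, {set 'I_(2 ^ m (level I))})
         (eps : forall I : dyadic, 'I_(2 ^ m (level I)) -> bool),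
    [/\ forall I, ht I = \sum_(K in A I) (-1) ^+ eps I K *: haar (dy K),
        Gam (A unit_itv) = `[0, 1[%classic,
        forall I, Gam (A (child true I)) = [set s | (\val (ht I) : R -> R) s = 1]
      & forall I, Gam (A (child false I)) = [set s | (\val (ht I) : R -> R) s = -1]].

Definition opA (ht kt : dyadic -> V1) (f : V2) : V2 :=
  \sum_(IJ \in [set: dyadic * dyadic])
    (ip (tensor (ht IJ.1) (kt IJ.2)) f / (dlen IJ.1 * dlen IJ.2))
      *: haar2 IJ.1 IJ.2.

Definition opB (ht kt : dyadic -> V1) (f : V2) : V2 :=
  \sum_(IJ \in [set: dyadic * dyadic])
    (ip (haar2 IJ.1 IJ.2) f / (dlen IJ.1 * dlen IJ.2))
      *: tensor (ht IJ.1) (kt IJ.2).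

End Haar.

Arguments V1 : clear implicits.
Arguments V2 : clear implicits.

Definition is_norm {R : realType} {V : lmodType R} (N : V -> R) : Prop :=
  [/\ forall f g, N (f + g) <= N f + N g,
      forall a f, N (a *: f) = `|a| * N f
    & forall f, N f = 0 -> f = 0].

(* sup {q (T x) : p x <= 1}, possibly +oo *)
Definition opnorm {R : realType} {E F : Type} (p : E -> R) (q : F -> R)
    (T : E -> F) : \bar R :=
  ereal_sup [set (q (T x))%:E | x in [set x | p x <= 1]].

Definition nonprincipal (U : set_system nat) : Prop :=
  UltraFilter U /\ forall n, ~ U [set n].

Section Capon.
Context {R : realType} {Z : completeNormedModType R}.
Local Notation nZ := (fun z : Z => `|z|).

(* Z, together with iota, is the completion of V2 under the norm N. *)
Definition is_completion (N : V2 R -> R) (iota : {linear V2 R -> Z}) : Prop :=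
  (forall f, `|iota f| = N f) /\ dense (range iota).

Definition bounded_op (T : Z -> Z) : Prop :=
  linear T /\ (opnorm nZ nZ T < +oo)%E.

Definition bounded_haar_mult (iota : V2 R -> Z) (D : Z -> Z)
    (d : dyadic -> dyadic -> R) : Prop :=
  bounded_op D /\
  forall I J, D (iota (haar2 I J)) = d I J *: iota (haar2 I J).

(* a C + b (Id - C) on V2, with C the Capon projection *)
Definition capon_comb (a b : R) (f : V2 R) : V2 R :=
  a *: capon f + b *: (f - capon f).

Definition capon_space (C : R) (N : V2 R -> R) (iota : V2 R -> Z) : Prop :=
  (forall (m n : nat -> nat) (ht kt : dyadic -> V1 R),
     faithful_haar m ht -> faithful_haar n kt ->
     (opnorm N N (opA ht kt) * opnorm N N (opB ht kt) <= C%:E)%E) /\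
  exists2 beta : R, 0 < beta &
    forall (D : Z -> Z) (d : dyadic -> dyadic -> R) (U : set_system nat),
      bounded_haar_mult iota D d -> nonprincipal U ->
      (opnorm N nZ
           (fun f => D (iota f) - iota (capon_comb (lambdaU U d) (muU U d) f))%R
         <= beta%:E * T2_norm d)%E.

Definition factors_through (S T : Z -> Z) : Prop :=
  exists A B : Z -> Z, [/\ bounded_op A, bounded_op B & S = A \o T \o B].

(* T is a C-projectional factor of S with error eta *)
Definition proj_factor (C eta : R) (T S : Z -> Z) : Prop :=
  exists A B : Z -> Z,
    [/\ bounded_op A, bounded_op B,
        (opnorm nZ nZ A * opnorm nZ nZ B <= C%:E)%E,
        A \o B = id
      & (opnorm nZ nZ (fun z => S z - A (T (B z)))%R <= eta%:E)%E].

End Capon.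

(* Main.v *)
(** The faithful Haar systems can be taken of Rademacher type: all signs are [+1] and
    [Gamma_I] is the set of points whose binary digits at the positions
    [m_0, ..., m_(i-1)] are those of [I].  The compression [A D B] of a multiplier [D]
    to such systems is the multiplier whose entry at [(I, J)] is the mean of [d] over
    [D_(m_i) x D_(n_j)] against the weights [prod_l (1 + r_l(I) r_(m_l))].  In the
    limit along the ultrafilter these means become bounded functionals of the weights,
    so by Bessel's inequality they almost vanish on [u * r_p] for [p] large.  Choosing
    [n_0, m_0, n_1, m_1, ...] in this order therefore makes the [T^2 S]-norm of [A D B]
    as small as desired, with root entries close to [lambda] and [mu] and with
    exactly the same [lambda] and [mu] as [D].

    Condition (b) for [A D B], whose [T^2]-norm is finite, shows that
    [S = lambda C + mu (Id - C)] is bounded; in particular [lambda = mu] if [C] is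
    unbounded.  As [C] has zero [T^2 S]-norm, condition (b) for [A D B - S], whose two
    functionals vanish, gives [||A D B - S|| <= 4 beta eps].  If [lambda mu <> 0], then
    [S] is invertible and so is a small perturbation of it, whence the identity
    factors through [D]; otherwise the same applies to [Id - D]. *)
Require Import Defs.
From HB Require Import structures.
From mathcomp Require Import all_boot all_order all_algebra finmap.
From mathcomp Require Import all_classical all_reals all_analysis.
From mathcomp Require Import ring lra.

Set Implicit Arguments.
Unset Strict Implicit.
Unset Printing Implicit Defensive.

Import Order.TTheory GRing.Theory Num.Theory.
Import numFieldNormedType.Exports.

Local Open Scope classical_set_scope.
Local Open Scope ring_scope.

(** * Binary digits and dyadic averages *)

(** Condition (b) says nothing about a multiplier of infinite T^2-norm, so it is only ever applied
    to compressions. The order of selection matches the two sides of the Capon diagonal: |I| <= |J|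
    means [level J <= level I]. In that case n_j is chosen before m_i, and the entry at (I, J) is
    compared with limits taken in m first, as in lambda; if [level I < level J], the opposite order
    applies, as in mu. Each of the four families of differences in the T^2 S-norm stays on one side
    of the diagonal, so the two orders of limits, which need not agree, never have to be compared.
    The factors k + 1 in the norm and the number of terms in its inner sums are absorbed by errors
    of order 2^-k / (k + 1).

    The functionals must be preserved exactly and not just approximately: an error in them would
    leave a small multiple of C, whose norm is not controlled. Exactness holds because level sums of
    the compression at (i, j) are level sums of [d] at (m_i, n_j). *)

Section Digits.
Context {R : realType}.
Implicit Types (K I J : dyadic) (u v : dyadic -> R).

(* The sign of the [p]-th binary digit of the points of [K]; meaningful only for
   [p < level K], as the subtraction is truncated. *)
Definition digit (p : nat) (K : dyadic) : R :=
  (-1) ^+ odd (tagged K %/ 2 ^ (level K - p.+1)).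

Lemma digit_child p w K : (p < level K)%N -> digit p (child w K) = digit p K.
Proof.
move=> pK; rewrite /digit; congr (_ ^+ (odd _)).
rewrite [level (child w K)]/= subSn // expnS divnMA.
congr (_ %/ _)%N; rewrite /= -muln2 divnMDl //.
by case: w; rewrite /= ?addn0.
Qed.

Lemma digit_child_last w K : digit (level K) (child w K) = (-1) ^+ ~~ w.
Proof.
rewrite /digit [level (child w K)]/= subnn divn1 /= oddD odd_double.
by case: w.
Qed.

Lemma digit_normr p K : `|digit p K| = 1.
Proof. by rewrite normr_sign. Qed.

Lemma digit_sqr p K : digit p K ^+ 2 = 1.
Proof. by rewrite sqrr_sign. Qed.

Lemma digit_mul p K : digit p K * digit p K = 1.
Proof. by rewrite -expr2 digit_sqr. Qed.

Definition avg (m : nat) u : R := 2 ^- m * \sum_(K < 2 ^ m) u (dy K).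

Lemma avgD m u v : avg m (fun K => u K + v K) = avg m u + avg m v.
Proof. by rewrite /avg big_split mulrDr. Qed.

Lemma avgZ m a u : avg m (fun K => a * u K) = a * avg m u.
Proof. by rewrite /avg -mulr_sumr mulrCA. Qed.

Lemma avg_cst m c : avg m (fun=> c) = c.
Proof.
rewrite /avg sumr_const card_ord -[c *+ _]mulr_natl natrX mulrA mulVf ?mul1r //.
Qed.

Lemma eq_avg m u v : (forall K, level K = m -> u K = v K) -> avg m u = avg m v.
Proof. by move=> uv; rewrite /avg; congr (_ * _); apply: eq_bigr => K _; exact: uv. Qed.

Lemma ler_avg m u v : (forall K, level K = m -> u K <= v K) -> avg m u <= avg m v.
Proof.
move=> uv; rewrite /avg ler_wpM2l ?invr_ge0 ?exprn_ge0 //.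
by apply: ler_sum => K _; exact: uv.
Qed.

Lemma ler_norm_avg m u : `|avg m u| <= avg m (fun K => `|u K|).
Proof.
rewrite /avg normrM ger0_norm ?invr_ge0 ?exprn_ge0 // ler_wpM2l ?invr_ge0 ?exprn_ge0 //.
exact: ler_norm_sum.
Qed.

Lemma exchange_avg m n (u : dyadic -> dyadic -> R) :
  avg m (fun K => avg n (u K)) = avg n (fun L => avg m (u^~ L)).
Proof.
rewrite /avg -!mulr_sumr [in LHS]mulrCA; congr (_ * (_ * _)).
exact: exchange_big.
Qed.

Lemma sum_expn2S (m : nat) (F : nat -> R) :
  \sum_(k < 2 ^ m.+1) F k = \sum_(k < 2 ^ m) (F k.*2 + F k.*2.+1).
Proof.
rewrite expnS mul2n.
elim: (2 ^ m)%N => [|n IH]; first by rewrite !big_ord0.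
by rewrite doubleS !big_ord_recr /= IH addrA.
Qed.

Lemma avgS m u :
  avg m.+1 u = avg m (fun K => (u (child true K) + u (child false K)) / 2).
Proof.
rewrite /avg exprS invfM -mulrA mulrCA; congr (_ * _).
(* [sum_expn2S] concerns functions on the natural numbers, so [u] is extended by 0 outside the index
   range. *)
pose F k := if insub k is Some K then u (@dy m.+1 K) else 0.
have FE (K : 'I_(2 ^ m.+1)) : F K = u (dy K) by rewrite /F valK.
rewrite -(eq_bigr _ (fun k _ => FE k)) sum_expn2S mulr_sumr.
apply: eq_bigr => K _; rewrite mulrC; congr (_ / _).
have chE w : u (child w (dy K)) = F (K.*2 + ~~ w)%N.
  by rewrite -FE /=.
by rewrite !chE addn0 addn1.
Qed.

Lemma avg_stable m n u : (m <= n)%N ->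
  (forall w K, (m <= level K)%N -> u (child w K) = u K) -> avg n u = avg m u.
Proof.
move=> mn us; rewrite -(subnK mn) addnC; elim: (n - m)%N => [|d IH]; first by rewrite addn0.
rewrite addnS avgS -IH; apply: eq_avg => K lK.
rewrite !us ?lK ?leq_addr //; lra.
Qed.

(** The digits are the Rademacher functions, orthonormal for the mean at every level [m >= P]. In
    the induction the last digit has opposite signs on the two children, so the cross term
    cancels. *)
Lemma avg_digits_sqr (x : nat -> R) P m : (P <= m)%N ->
  avg m (fun K => (\sum_(p < P) x p * digit p K) ^+ 2) = \sum_(p < P) x p ^+ 2.
Proof.
have stab Q w K : (Q <= level K)%N ->
    \sum_(p < Q) x p * digit p (child w K) = \sum_(p < Q) x p * digit p K.
  by move=> QK; apply: eq_bigr => p _; rewrite digit_child // (leq_trans _ QK).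
move=> Pm; rewrite (avg_stable Pm); last by move=> w K PK; rewrite stab.
elim: P {Pm} => [|P IH].
  rewrite big_ord0 -[RHS](avg_cst 0); apply: eq_avg => K _.
  by rewrite big_ord0 expr0n.
rewrite avgS [in RHS]big_ord_recr /= -IH -(avg_cst P (x P ^+ 2)) -avgD.
apply: eq_avg => K lK.
rewrite !big_ord_recr /= !stab ?lK // -lK !digit_child_last /= expr0 expr1.
by field.
Qed.

(* [2^i] times the indicator of the union of the intervals whose digits at
   positions [mu 0], ..., [mu (i - 1)] are those of [I], where [i = level I]. *)
Definition weight (mu : nat -> nat) (I K : dyadic) : R :=
  \prod_(l < level I) (1 + digit l I * digit (mu l) K).

Lemma weight_unit mu K : weight mu unit_itv K = 1.
Proof. by rewrite /weight big_ord0. Qed.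

(** Passing to a child changes a weight by plus or minus the weight times a single new digit. These
    products are the functions that become negligible when the position of the digit is large. *)
Lemma weight_child mu w I K :
  weight mu (child w I) K =
  weight mu I K + (-1) ^+ (~~ w) * (weight mu I K * digit (mu (level I)) K).
Proof.
rewrite /weight [level (child w I)]/= big_ord_recr /= digit_child_last.
have -> : \prod_(l < level I) (1 + digit l (child w I) * digit (mu l) K) =
    \prod_(l < level I) (1 + digit l I * digit (mu l) K).
  by apply: eq_bigr => l _; rewrite digit_child.
by rewrite mulrDr mulr1 mulrCA.
Qed.

(** A weight depends on finitely many frequencies only, which permits choosing them one after
    another. *)
Lemma eq_weight mu nu I K :
  (forall l, (l < level I)%N -> mu l = nu l) -> weight mu I K = weight nu I K.
Proof. by move=> h; apply: eq_bigr => l _; rewrite h. Qed.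

Lemma weight_ge0 mu I K : 0 <= weight mu I K.
Proof.
apply: prodr_ge0 => l _; rewrite /digit -signr_addb.
by case: (_ (+) _) => /=; rewrite ?expr1 ?expr0; lra.
Qed.

Lemma weight_le mu I K : weight mu I K <= 2 ^+ level I.
Proof.
rewrite -[X in _ ^+ X]card_ord -prodr_const.
apply: ler_prod => l _; rewrite /digit -signr_addb.
by case: (_ (+) _) => /=; rewrite ?expr1 ?expr0; lra.
Qed.

Lemma weightE mu I K : weight mu I K =
  if [forall l : 'I_(level I), digit (mu l) K == digit l I] then 2 ^+ level I else 0.
Proof.
rewrite /weight; case: ifPn => [/forallP h|].
  rewrite (eq_bigr (fun=> 2)) ?prodr_const ?card_ord // => l _.
  by rewrite (eqP (h l)) digit_mul; ring.
rewrite negb_forall => /existsP[l hl]; rewrite (bigD1 l) //=.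
suff -> : 1 + digit l I * digit (mu l) K = 0 by rewrite mul0r.
move: hl; rewrite /digit; do 2 case: odd => /=; rewrite ?expr1 ?expr0 ?eqxx //= => _; ring.
Qed.

(** For fixed [K] the last factors of two siblings average to 1. This partition of unity in [I] is
    what makes the compression preserve level sums. *)
Lemma avg_weight mu i K : avg i (fun I => weight mu I K) = 1.
Proof.
elim: i => [|i IH].
  rewrite -[RHS](avg_cst 0); apply: eq_avg => I lI.
  by rewrite /weight lI big_ord0.
rewrite avgS -[RHS]IH; apply: eq_avg => I _.
by rewrite !weight_child /= expr0 expr1; field.
Qed.

End Digits.

(** * Limits along an ultrafilter *)

Section UltraLimit.
Context {R : realType} (U : set_system nat).
Hypothesis hU : nonprincipal U.
Implicit Types (f g : nat -> R) (u v : dyadic -> R) (a b c l tau : R).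

Let UF : UltraFilter U := hU.1.
#[local] Existing Instance UF.

Definition ulim f : R := lim (f @ U).

(** A non-principal ultrafilter contains the complement of each singleton, hence every cofinite
    set. *)
Lemma eventuallyU (P : nat -> Prop) : (exists n0, forall n, (n0 <= n)%N -> P n) ->
  \forall n \near U, P n.
Proof.
case=> n0 nP; have notin n : U (~` [set n]).
  by case: (in_ultra_setVsetC [set n] UF) => // /(hU.2 n).
have : \forall n \near U, forall i : 'I_n0, n <> i :> nat.
  by apply: filter_forall => i; exact: notin.
apply: filterS => n ni; apply: nP; rewrite leqNgt; apply/negP => nn0.
exact: (ni (Ordinal nn0)).
Qed.

(** Compactness of [[- c, c]], in the form that ultrafilters on it converge. Hence [lim], which has
    a default value where no limit exists, is a genuine limit on bounded sequences. *)
Lemma ulim_cvg f c : (forall n, `|f n| <= c) -> f @ U --> ulim f.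
Proof.
move=> fc.
have: U (f @^-1` `[- c, c]).
  by apply: filterS filterT => n _ /=; rewrite in_itv /= -ler_norml.
have := @segment_compact R (- c) c; rewrite compact_ultra => cpt fU.
have fUF : UltraFilter (f @ U).
  split=> [|G GF sG]; first exact: fmap_proper_filter.
  apply/seteqP; split=> // A GA.
  case: (in_ultra_setVsetC (f @^-1` A) UF) => // fAC.
  have /(filterI GA) : G (~` A) by apply: sG.
  by rewrite setICr => /filter_not_empty.
have [l [_ fl]] := cpt _ fUF fU.
by apply/cvg_ex; exists l.
Qed.

Lemma ulim_near f c tau : (forall n, `|f n| <= c) -> 0 < tau ->
  \forall n \near U, `|f n - ulim f| <= tau.
Proof.
move=> fc tau0; have /cvgrPdist_le/(_ _ tau0) := ulim_cvg fc.
by apply: filterS => n; rewrite distrC.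
Qed.

Lemma cvg_ulim f l : f @ U --> l -> ulim f = l.
Proof. exact: cvg_lim. Qed.

Lemma ulimD f g c : (forall n, `|f n| <= c) -> (forall n, `|g n| <= c) ->
  ulim (fun n => f n + g n) = ulim f + ulim g.
Proof. by move=> fc gc; apply: cvg_ulim; apply: cvgD; [apply: ulim_cvg fc|apply: ulim_cvg gc]. Qed.

Lemma ulimZ a f c : (forall n, `|f n| <= c) ->
  ulim (fun n => a * f n) = a * ulim f.
Proof. by move=> fc; apply: cvg_ulim; apply: cvgMr; exact: ulim_cvg fc. Qed.

Lemma ulim_cst a : ulim (fun=> a) = a.
Proof. by apply: cvg_ulim; exact: cvg_cst. Qed.

Lemma ulim_le f c b : (forall n, `|f n| <= c) -> (\forall n \near U, `|f n| <= b) ->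
  `|ulim f| <= b.
Proof.
move=> fc fb; apply/ler_addgt0Pr => e e0.
have [n [h1 h2]] := filter_ex (filterI fb (ulim_near fc e0)).
by have := lerB_dist (ulim f) (f n); rewrite distrC; lra.
Qed.

Lemma cvgn_ulim f l : f @ \oo --> l -> ulim f = l.
Proof.
move=> /cvgrPdist_le fl; apply: cvg_ulim; apply/cvgrPdist_le => e e0.
have [n0 _ h] := fl _ e0; apply: eventuallyU; exists n0 => n; exact: h.
Qed.

End UltraLimit.

(** * Functionals dominated by mean absolute values *)

Section AverageFunctionals.
Context {R : realType}.
Implicit Types (u v y : dyadic -> R) (Phi : (dyadic -> R) -> R) (a b c e tau B : R).

Definition bounded_fun u := exists c, forall K, `|u K| <= c.

(* The second clause says that |Phi u| <= B * limsup_m avg_m |u|. *)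
Definition avg_functional (B : R) Phi :=
  (forall u v a, bounded_fun u -> bounded_fun v ->
     Phi (fun K => u K + a * v K) = Phi u + a * Phi v) /\
  (forall u c, bounded_fun u ->
     (exists m0, forall m, (m0 <= m)%N -> avg m (fun K => `|u K|) <= c) ->
     `|Phi u| <= B * c).

Lemma ler_norm_avgW m u c : (forall K, `|u K| <= c) -> `|avg m u| <= c.
Proof.
move=> uc; apply: le_trans (ler_norm_avg _ _) _.
by rewrite -[leRHS](avg_cst m); apply: ler_avg.
Qed.

Lemma bounded_funM u v : bounded_fun u -> bounded_fun v ->
  bounded_fun (fun K => u K * v K).
Proof.
move=> [a ua] [b vb]; exists (a * b) => K.
by rewrite normrM ler_pM.
Qed.

Lemma bounded_funD u v : bounded_fun u -> bounded_fun v ->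
  bounded_fun (fun K => u K + v K).
Proof.
move=> [a ua] [b vb]; exists (a + b) => K.
by apply: le_trans (ler_normD _ _) _; rewrite lerD.
Qed.

Lemma bounded_fun_cst a : bounded_fun (fun=> a).
Proof. by exists `|a|. Qed.

Lemma bounded_fun_digit p : bounded_fun (digit p).
Proof. by exists 1 => K; rewrite digit_normr. Qed.

Lemma bounded_fun_sum (x : nat -> R) (v : nat -> dyadic -> R) P :
  (forall p, bounded_fun (v p)) -> bounded_fun (fun K => \sum_(p < P) x p * v p K).
Proof.
move=> bv; elim: P => [|P IH].
  by exists 0 => K; rewrite big_ord0 normr0.
have [c hc] : bounded_fun (fun K => \sum_(p < P) x p * v p K + x P * v P K).
  by apply: bounded_funD => //; apply: bounded_funM => //; exact: bounded_fun_cst.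
by exists c => K; rewrite big_ord_recr; exact: hc.
Qed.

Lemma avg_functional_sum B Phi : avg_functional B Phi ->
  forall (x : nat -> R) (v : nat -> dyadic -> R) P, (forall p, bounded_fun (v p)) ->
  Phi (fun K => \sum_(p < P) x p * v p K) = \sum_(p < P) x p * Phi (v p).
Proof.
move=> [lin bnd] x v P bv; elim: P => [|P IH].
  rewrite big_ord0; apply/eqP; rewrite -normr_le0 -[leRHS](mulr0 B).
  apply: bnd; first by exists 0 => K; rewrite big_ord0 normr0.
  exists 0%N => m _; rewrite -[leRHS](avg_cst m); apply: ler_avg => K _.
  by rewrite big_ord0 normr0.
rewrite big_ord_recr /= -IH -lin //; last exact: bounded_fun_sum.
by congr Phi; apply/funext => K; rewrite big_ord_recr.
Qed.

(** Cauchy-Schwarz, obtained pointwise from |y| <= b / 2 + y^2 / (2 b) with [b = c + e]; the slack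
    [e] keeps [b] positive when [c = 0]. *)
Lemma avg_norm_le y c m : 0 <= c -> avg m (fun K => y K ^+ 2) <= c ^+ 2 ->
  avg m (fun K => `|y K|) <= c.
Proof.
move=> c0 yc; apply/ler_addgt0Pr => e e0.
have ce : 0 < c + e by lra.
suff h : avg m (fun K => `|y K|) <= avg m (fun K => (c + e) / 2 + (2 * (c + e))^-1 * y K ^+ 2).
  apply: (le_trans h); rewrite avgD avg_cst avgZ.
  have : (2 * (c + e))^-1 * avg m (fun K => y K ^+ 2) <= (2 * (c + e))^-1 * (c + e) ^+ 2.
    rewrite ler_wpM2l ?invr_ge0 //; first lra.
    by apply: (le_trans yc); rewrite lerXn2r ?nnegrE //; lra.
  have -> : (2 * (c + e))^-1 * (c + e) ^+ 2 = (c + e) / 2 by field; lra.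
  lra.
apply: ler_avg => K _; rewrite -subr_ge0.
have -> : (c + e) / 2 + (2 * (c + e))^-1 * y K ^+ 2 - `|y K| =
    (c + e - `|y K|) ^+ 2 / (2 * (c + e)).
  by rewrite -(real_normK (num_real (y K))); field; lra.
by rewrite divr_ge0 ?sqr_ge0 //; lra.
Qed.

(* Bessel's inequality for the orthonormal system of the digits, tested on the
   weights [u * digit p]. *)
Lemma avg_functional_digit B Phi u tau : 0 <= B -> avg_functional B Phi ->
  bounded_fun u -> 0 < tau ->
  exists p0, forall p, (p0 <= p)%N -> `|Phi (fun K => u K * digit p K)| <= tau.
Proof.
move=> B0 hPhi bu tau0; have [a ua] := bu.
have a0 : 0 <= a by apply: le_trans (normr_ge0 _) (ua unit_itv).
pose x p := Phi (fun K => u K * digit p K).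
have bessel P : \sum_(p < P) x p ^+ 2 <= (B * a) ^+ 2.
  set s := \sum_(p < P) _.
  have s0 : 0 <= s by apply: sumr_ge0 => p _; exact: sqr_ge0.
  pose y K := \sum_(p < P) x p * digit p K.
  have by_ : bounded_fun y by apply: bounded_fun_sum => p; exact: bounded_fun_digit.
  have Es : Phi (fun K => u K * y K) = s.
    have -> : (fun K => u K * y K) = (fun K => \sum_(p < P) x p * (u K * digit p K)).
      by apply/funext => K; rewrite /y mulr_sumr; apply: eq_bigr => p _; rewrite mulrCA.
    rewrite (avg_functional_sum hPhi x (v := fun p K => u K * digit p K)).
      by apply: eq_bigr => p _; rewrite expr2.
    by move=> p; apply: bounded_funM => //; exact: bounded_fun_digit.
  (* From level [P] on, the mean of y^2 is [s], so the mean of |y| is at most its square root. This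
     gives s <= B a sqrt(s), and division by sqrt(s) bounds [s] independently of [P]. *)
  have : `|Phi (fun K => u K * y K)| <= B * (a * Num.sqrt s).
    apply: hPhi.2; first exact: bounded_funM.
    exists P => m Pm; apply: (@le_trans _ _ (a * avg m (fun K => `|y K|))).
      by rewrite -avgZ; apply: ler_avg => K _; rewrite normrM ler_wpM2r.
    rewrite ler_wpM2l // avg_norm_le ?sqrtr_ge0 //.
    by rewrite sqr_sqrtr // avg_digits_sqr.
  rewrite Es ger0_norm // mulrA => h.
  have := sqr_sqrtr s0; have := sqrtr_ge0 s; move: h.
  move: (Num.sqrt s) (B * a) (mulr_ge0 B0 a0) => c b b0 h c0 sc; rewrite -sc in h *.
  rewrite lerXn2r ?nnegrE //; have [->//|c1] := eqVneq c 0.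
  by rewrite -(@ler_pM2r _ c) ?lt_neqAle ?c0 ?andbT 1?eq_sym // -expr2.
have cvgx : cvgn (series (fun p => x p ^+ 2)).
  apply: nondecreasing_is_cvgn.
    by apply/nondecreasing_seqP => n; rewrite seriesSr lerDl sqr_ge0.
  by exists ((B * a) ^+ 2) => _ [n _ <-]; rewrite /series /= big_mkord.
have /cvgrPdist_le/(_ (tau ^+ 2)) := cvg_series_cvg_0 cvgx.
case; first by rewrite exprn_gt0.
move=> p0 _ h; exists p0 => p /h /=.
rewrite sub0r normrN ger0_norm ?sqr_ge0 // -real_normK ?num_real // => h2.
by rewrite -(@ler_pXn2r _ 2) ?nnegrE // ltW.
Qed.

End AverageFunctionals.

(** * Iterated limits of bilinear averages *)

Section BilinearLimits.
Context {R : realType} (U : set_system nat).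
Hypothesis hU : nonprincipal U.
Implicit Types (u v : dyadic -> R) (d : dyadic -> dyadic -> R) (a b c tau B : R).

(** Domination is asked only for large [n], with a threshold depending on [u]: for averages taken at
    level [n] itself, the mean of |u| is controlled only from some level on. *)
Lemma ulim_avg_functional (B : R) (Phi : nat -> (dyadic -> R) -> R) :
  (forall n u v a, bounded_fun u -> bounded_fun v ->
     Phi n (fun K => u K + a * v K) = Phi n u + a * Phi n v) ->
  (forall u, bounded_fun u -> exists c, forall n, `|Phi n u| <= c) ->
  (forall u c, bounded_fun u ->
     (exists m0, forall m, (m0 <= m)%N -> avg m (fun K => `|u K|) <= c) ->
     exists n0, forall n, (n0 <= n)%N -> `|Phi n u| <= B * c) ->
  avg_functional B (fun u => ulim U (fun n => Phi n u)).
Proof.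
move=> lin bnd ctr; split.
  move=> u v a bu bv; have [c hc] := bnd u bu; have [c' hc'] := bnd v bv.
  under [X in ulim U X]eq_fun do rewrite lin //.
  rewrite (ulimD hU (c := Num.max c (`|a| * c'))) ?(ulimZ hU _ hc') // => n.
    by rewrite le_max hc.
  by rewrite le_max normrM ler_wpM2l ?orbT.
move=> u c bu uc; have [c0 hc0] := bnd u bu.
apply: (ulim_le hU hc0); apply: (eventuallyU hU); exact: ctr.
Qed.

(* With u = v = 1, [bilin], [lim2 d] and [lim2 (transp d)] are the level sum, lambda
   and mu. *)
Definition bilin d u m v n : R := avg m (fun K => u K * avg n (fun L => v L * d K L)).

Definition lim1 d u v n : R := ulim U (fun m => bilin d u m v n).

Definition lim2 d u v : R := ulim U (fun n => lim1 d u v n).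

Definition transp d : dyadic -> dyadic -> R := fun K L => d L K.

(** Finite Fubini: an estimate in one variable gives the same estimate in the other. *)
Lemma bilin_transp d u m v n : bilin (transp d) v n u m = bilin d u m v n.
Proof.
rewrite /bilin; transitivity (avg n (fun L => avg m (fun K => u K * (v L * d K L)))).
  apply: eq_avg => L _; rewrite -avgZ; apply: eq_avg => K _; rewrite /transp; ring.
rewrite exchange_avg; apply: eq_avg => K _; exact: avgZ.
Qed.

Lemma bilin_linl d u v a w m n :
  bilin d (fun K => u K + a * v K) m w n = bilin d u m w n + a * bilin d v m w n.
Proof. by rewrite /bilin -avgZ -avgD; apply: eq_avg => K _; ring. Qed.

Lemma bilin_linr d u v a w m n :
  bilin d w m (fun K => u K + a * v K) n = bilin d w m u n + a * bilin d w m v n.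
Proof. by rewrite -!(bilin_transp d) bilin_linl. Qed.

Lemma bilin_lel d B u v b m n : (forall K L, `|d K L| <= B) -> (forall L, `|v L| <= b) ->
  `|bilin d u m v n| <= b * B * avg m (fun K => `|u K|).
Proof.
move=> dB vb; apply: le_trans (ler_norm_avg _ _) _; rewrite -avgZ.
apply: ler_avg => K _; rewrite normrM mulrC ler_wpM2r //.
by apply: ler_norm_avgW => L; rewrite normrM ler_pM.
Qed.

Lemma bilin_ler d B u v a m n : (forall K L, `|d K L| <= B) -> (forall K, `|u K| <= a) ->
  `|bilin d u m v n| <= a * B * avg n (fun L => `|v L|).
Proof. by move=> dB ua; rewrite -(bilin_transp d); apply: bilin_lel => // K L; exact: dB. Qed.

Section Bounded.
Variables (d : dyadic -> dyadic -> R) (B : R).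
Hypothesis dB : forall K L, `|d K L| <= B.

Let B0 : 0 <= B. Proof. exact: le_trans (normr_ge0 _) (dB unit_itv unit_itv). Qed.

Lemma bilin_bounded u v : bounded_fun u -> bounded_fun v ->
  exists c, forall m n, `|bilin d u m v n| <= c.
Proof.
move=> [a ua] [b vb]; exists (a * (b * B)) => m n; apply: ler_norm_avgW => K.
rewrite normrM ler_pM //; apply: ler_norm_avgW => L.
by rewrite normrM ler_pM.
Qed.

Lemma lim1_bounded u v : bounded_fun u -> bounded_fun v ->
  exists c, forall n, `|lim1 d u v n| <= c.
Proof.
move=> bu bv; have [c hc] := bilin_bounded bu bv; exists c => n.
apply: (ulim_le hU (c := c)) => //.
by apply: (eventuallyU hU); exists 0%N.
Qed.

Lemma lim1_functional v : bounded_fun v ->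
  exists2 C, 0 <= C & forall n, avg_functional C (fun u => lim1 d u v n).
Proof.
move=> bv; have [b vb] := bv.
exists (b * B) => [|n]; first by rewrite mulr_ge0 // (le_trans _ (vb unit_itv)).
apply: ulim_avg_functional => [m u w a _ _|u bu|u c bu [m0 hm0]].
- exact: bilin_linl.
- by have [c hc] := bilin_bounded bu bv; exists c => m; exact: hc.
- exists m0 => m /hm0 h; apply: le_trans (bilin_lel _ _ _ dB vb) _.
  by rewrite ler_wpM2l // mulr_ge0 // (le_trans _ (vb unit_itv)).
Qed.

(** The inner limit is already a functional of [u], with a constant independent of [n], and the
    outer limit preserves this. *)
Lemma lim2_functionall v : bounded_fun v ->
  exists2 C, 0 <= C & avg_functional C (fun u => lim2 d u v).
Proof.
move=> bv; have [C C0 hC] := lim1_functional bv; exists C => //.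
apply: ulim_avg_functional => [n u w a bu bw|u bu|u c bu uc].
- exact: (hC n).1.
- exact: lim1_bounded.
- by exists 0%N => n _; apply: (hC n).2.
Qed.

(** The inner limit leaves [v] averaged at level [n], so [lim1] is at most a constant times the mean
    of |v| at that level; the domination then arises in the outer limit. *)
Lemma lim2_functionalr u : bounded_fun u ->
  exists2 C, 0 <= C & avg_functional C (fun v => lim2 d u v).
Proof.
move=> bu; have [a ua] := bu.
have C0 : 0 <= a * B by rewrite mulr_ge0 // (le_trans _ (ua unit_itv)).
exists (a * B) => //.
apply: ulim_avg_functional => [n v w b bv bw|v bv|v c bv [n0 hn0]].
- have [c hc] := bilin_bounded bu bv; have [c' hc'] := bilin_bounded bu bw.
  rewrite /lim1; under [X in ulim U X]eq_fun do rewrite bilin_linr.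
  rewrite (ulimD hU (c := Num.max c (`|b| * c'))) => [|m|m].
  + by rewrite (ulimZ hU _ (c := c')).
  + by rewrite le_max hc.
  + by rewrite le_max normrM ler_wpM2l ?orbT.
- exact: lim1_bounded.
- exists n0 => n /hn0 h; apply: le_trans (_ : a * B * avg n (fun K => `|v K|) <= _).
    have [c' hc'] := bilin_bounded bu bv.
    apply: (ulim_le hU (c := c')) => //; apply: (eventuallyU hU).
    by exists 0%N => m _; apply: bilin_ler.
  by rewrite ler_wpM2l.
Qed.

Lemma bilin_near u v n tau : bounded_fun u -> bounded_fun v -> 0 < tau ->
  \forall m \near U, `|bilin d u m v n - lim1 d u v n| <= tau.
Proof.
move=> bu bv tau0; have [c hc] := bilin_bounded bu bv.
exact: (ulim_near hU (c := c)).
Qed.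

Lemma lim1_near u v tau : bounded_fun u -> bounded_fun v -> 0 < tau ->
  \forall n \near U, `|lim1 d u v n - lim2 d u v| <= tau.
Proof.
by move=> bu bv tau0; have [c hc] := lim1_bounded bu bv; exact: (ulim_near hU hc).
Qed.

End Bounded.

End BilinearLimits.

(** * Selection of the frequencies *)

Section Selection.
Context {R : realType} (U : set_system nat).
Hypothesis hU : nonprincipal U.
Variables (d : dyadic -> dyadic -> R) (B : R).
Hypothesis dB : forall K L, `|d K L| <= B.

Let UF : UltraFilter U := hU.1.
#[local] Existing Instance UF.

Lemma bounded_weight mu I : bounded_fun (weight (R := R) mu I).
Proof. by exists (2 ^+ level I) => K; rewrite ger0_norm ?weight_ge0 ?weight_le. Qed.

Lemma filter_nat k (P : nat -> nat -> Prop) :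
  (forall l, (l < k)%N -> \forall x \near U, P l x) ->
  \forall x \near U, forall l, (l < k)%N -> P l x.
Proof.
move=> h; have : \forall x \near U, forall l : 'I_k, P l x.
  by apply: filter_forall => l; exact: h.
by apply: filterS => x hx l lk; exact: (hx (Ordinal lk)).
Qed.

Lemma filter_dyadic k (P : dyadic -> nat -> Prop) :
  (forall I, \forall x \near U, P I x) ->
  \forall x \near U, forall I, (level I <= k)%N -> P I x.
Proof.
move=> h; have : \forall x \near U, forall i, (i < k.+1)%N ->
    forall I : 'I_(2 ^ i), P (dy I) x.
  by apply: filter_nat => i _; apply: filter_forall => I; exact: h.
by apply: filterS => x hx [i I] /= ik; exact: (hx i).
Qed.

(* The requirements on a new frequency [x]: with [e = d], [mu k = x] is chosen when
   [mu] is known below [k] and [nu] up to [k]; with [e = transp d] and the roles of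
   [mu] and [nu] exchanged, [nu k = x] is chosen when both are known below [k]. *)
Definition good_freq e (tau : R) mu nu (k k' ks x : nat) :=
  forall I J, (level I <= k)%N -> (level J <= k')%N ->
  let u := weight (R := R) mu I in let v := weight nu J in
  let ur := (fun K => u K * digit x K) in
  [/\ forall l, (l < ks)%N ->
        `|bilin e u x v (nu l) - lim1 U e u v (nu l)| <= tau /\
        `|lim1 U e ur v (nu l)| <= tau,
      `|lim1 U (transp e) v u x - lim2 U (transp e) v u| <= tau,
      `|lim2 U (transp e) v ur| <= tau &
      `|lim2 U e ur v| <= tau].

(** Only finitely many [I], [J] and [l] occur, so the requirements can be intersected. Closeness to
    a limit comes from convergence along [U], smallness on the products with [digit x] from Bessel's
    inequality. *)
Lemma good_freq_near e tau mu nu k k' ks : (forall K L, `|e K L| <= B) -> 0 < tau ->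
  \forall x \near U, good_freq e tau mu nu k k' ks x.
Proof.
move=> eB tau0; have eB' K L : `|transp e K L| <= B by exact: eB.
suff : \forall x \near U, forall I, (level I <= k)%N -> forall J, (level J <= k')%N ->
  let u := weight (R := R) mu I in let v := weight nu J in
  let ur := (fun K => u K * digit x K) in
  [/\ forall l, (l < ks)%N ->
        `|bilin e u x v (nu l) - lim1 U e u v (nu l)| <= tau /\
        `|lim1 U e ur v (nu l)| <= tau,
      `|lim1 U (transp e) v u x - lim2 U (transp e) v u| <= tau,
      `|lim2 U (transp e) v ur| <= tau &
      `|lim2 U e ur v| <= tau].
  by apply: filterS => x hx I J Ik; apply: hx.
apply: filter_dyadic => I; apply: filter_dyadic => J /=.
set u := weight mu I; set v := weight nu J.
have bu : bounded_fun u by exact: bounded_weight.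
have bv : bounded_fun v by exact: bounded_weight.
have n1 : \forall x \near U, forall l, (l < ks)%N ->
    `|bilin e u x v (nu l) - lim1 U e u v (nu l)| <= tau /\
    `|lim1 U e (fun K => u K * digit x K) v (nu l)| <= tau.
  apply: filter_nat => l _; apply: filterI; first exact: (bilin_near hU eB).
  have [C C0 hC] := lim1_functional hU eB bv.
  by apply: (eventuallyU hU); apply: (avg_functional_digit C0 (hC (nu l))).
have n2 := lim1_near hU eB' bv bu tau0.
have n3 : \forall x \near U, `|lim2 U (transp e) v (fun K => u K * digit x K)| <= tau.
  have [C C0 hC] := lim2_functionalr hU eB' bv.
  by apply: (eventuallyU hU); apply: (avg_functional_digit C0 hC).
have n4 : \forall x \near U, `|lim2 U e (fun K => u K * digit x K) v| <= tau.
  have [C C0 hC] := lim2_functionall hU eB bv.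
  by apply: (eventuallyU hU); apply: (avg_functional_digit C0 hC).
by apply: filterS (filterI (filterI n1 n2) (filterI n3 n4)) => x [[? ?] []].
Qed.

(** [nu] enters both through weights of level at most [k'] and through the values [nu l] with
    [l < ks], whence the maximum. *)
Lemma eq_good_freq e tau mu nu mu' nu' k k' ks x :
  (forall l, (l < k)%N -> mu l = mu' l) ->
  (forall l, (l < maxn k' ks)%N -> nu l = nu' l) ->
  good_freq e tau mu nu k k' ks x -> good_freq e tau mu' nu' k k' ks x.
Proof.
move=> emu enu h I J Ik Jk.
have -> : weight (R := R) mu' I = weight mu I.
  by apply/funext => K; apply: eq_weight => l lI; rewrite emu // (leq_trans lI).
have -> : weight (R := R) nu' J = weight nu J.
  apply/funext => K; apply: eq_weight => l lJ; rewrite enu // leq_max.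
  by rewrite (leq_trans lJ).
have [h1 h2 h3 h4] := h I J Ik Jk; split=> // l lks.
by rewrite -enu ?leq_max ?lks ?orbT //; exact: h1.
Qed.

(** The requirement at [k] may involve all earlier values, so the choice function takes a whole
    prefix. Later steps do not alter earlier values, and [Q k] looks only at indices up to [k], so
    the diagonal sequence inherits it. *)
Lemma dependent_choice (T : Type) (x0 : T) (Q : nat -> (nat -> T) -> Prop) :
  (forall k f g, (forall l, (l <= k)%N -> f l = g l) -> Q k f -> Q k g) ->
  (forall k f, exists x, Q k (fun l => if l == k then x else f l)) ->
  exists f, forall k, Q k f.
Proof.
move=> Qext Qex; have /choice[c hc] : forall kf : nat * (nat -> T),
    exists x, Q kf.1 (fun l => if l == kf.1 then x else kf.2 l).
  by move=> [k f]; exact: Qex.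
pose F := fix F k := if k is k'.+1
  then (fun l => if l == k' then c (k', F k') else F k' l) else fun=> x0.
have FE k l : (l < k)%N -> F k l = F l.+1 l.
  elim: k => // k IH; rewrite ltnS leq_eqVlt => /predU1P[->//|lk].
  by rewrite -IH //= (ltn_eqF lk).
exists (fun l => F l.+1 l) => k; apply: Qext (hc (k, F k)) => l lk.
exact: (FE k.+1).
Qed.

Lemma select_frequencies (tau : nat -> R) : (forall k, 0 < tau k) ->
  exists mu nu : nat -> nat,
    [/\ {homo mu : i j / (i < j)%N}, {homo nu : i j / (i < j)%N},
        forall k, good_freq (transp d) (tau k) nu mu k k k (nu k) &
        forall k, good_freq d (tau k) mu nu k k.+1 k.+1 (mu k)].
Proof.
move=> tau0.
pose Q k (f : nat -> nat * nat) :=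
  let mu := fun l => (f l).1 in let nu := fun l => (f l).2 in
  [/\ forall l, (l < k)%N -> (mu l < mu k)%N, forall l, (l < k)%N -> (nu l < nu k)%N,
      good_freq (transp d) (tau k) nu mu k k k (nu k) &
      good_freq d (tau k) mu nu k k.+1 k.+1 (mu k)].
have [||f hf] := @dependent_choice _ (0, 0)%N Q.
- move=> k f g fg [h1 h2 h3 h4]; split=> [l lk|l lk||].
  + by rewrite -(fg l) ?(ltnW lk) // -(fg k) //; exact: h1.
  + by rewrite -(fg l) ?(ltnW lk) // -(fg k) //; exact: h2.
  + rewrite -fg //; apply: eq_good_freq h3 => l; first by move=> lk; rewrite fg 1?ltnW.
    by rewrite maxnn => lk; rewrite fg 1?ltnW.
  + rewrite -fg //; apply: eq_good_freq h4 => l; first by move=> lk; rewrite fg 1?ltnW.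
    by rewrite maxnn ltnS => lk; rewrite fg.
- move=> k f; pose mu l := (f l).1; pose nu l := (f l).2.
  have large (g : nat -> nat) : \forall x \near U, forall l, (l < k)%N -> (g l < x)%N.
    apply: filter_nat => l _; apply: (eventuallyU hU); by exists (g l).+1.
  have := good_freq_near nu mu k k k (fun K L => dB L K) (tau0 k).
  move=> /(filterI (large nu))/filter_ex[n [nun hn]].
  (* The choice of [mu k] must already know [nu k]: it involves weights of level [k.+1] in [nu] and
     the value at [l = k]. *)
  pose nu' l := if l == k then n else nu l.
  have := good_freq_near mu nu' k k.+1 k.+1 dB (tau0 k).
  move=> /(filterI (large mu))/filter_ex[m [mum hm]].
  exists (m, n); split=> [l lk|l lk||]; rewrite ?eqxx.
  + by rewrite (ltn_eqF lk) mum.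
  + by rewrite (ltn_eqF lk) nun.
  + apply: eq_good_freq hn => l; rewrite ?maxnn => lk; by rewrite (ltn_eqF lk).
  + apply: eq_good_freq hm => l; first by move=> lk; rewrite (ltn_eqF lk).
    by move=> _; rewrite /nu'; case: eqP.
exists (fun l => (f l).1), (fun l => (f l).2); split.
- by move=> i j ij; have [h _ _ _] := hf j; exact: h.
- by move=> i j ij; have [_ h _ _] := hf j; exact: h.
- by move=> k; have [_ _ h _] := hf k.
- by move=> k; have [_ _ _ h] := hf k.
Qed.

Lemma functional_weight_child C (Phi : (dyadic -> R) -> R) mu w I : avg_functional C Phi ->
  Phi (weight mu (child w I)) = Phi (weight mu I) +
    (-1) ^+ (~~ w) * Phi (fun K => weight mu I K * digit (mu (level I)) K).
Proof.
move=> [lin _]; rewrite -lin.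
- by congr Phi; apply/funext => K; exact: weight_child.
- exact: bounded_weight.
- by apply: bounded_funM; [exact: bounded_weight|exact: bounded_fun_digit].
Qed.

Lemma lim1_child e mu w I v n : (forall K L, `|e K L| <= B) -> bounded_fun v ->
  lim1 U e (weight mu (child w I)) v n = lim1 U e (weight mu I) v n +
    (-1) ^+ (~~ w) * lim1 U e (fun K => weight mu I K * digit (mu (level I)) K) v n.
Proof.
move=> eB bv; have [C _ hC] := lim1_functional hU eB bv.
exact: (functional_weight_child _ _ _ (hC n)).
Qed.

Lemma lim2_childl e mu w I v : (forall K L, `|e K L| <= B) -> bounded_fun v ->
  lim2 U e (weight mu (child w I)) v = lim2 U e (weight mu I) v +
    (-1) ^+ (~~ w) * lim2 U e (fun K => weight mu I K * digit (mu (level I)) K) v.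
Proof.
move=> eB bv; have [C _ hC] := lim2_functionall hU eB bv.
exact: (functional_weight_child _ _ _ hC).
Qed.

Lemma lim2_childr e nu x J u : (forall K L, `|e K L| <= B) -> bounded_fun u ->
  lim2 U e u (weight nu (child x J)) = lim2 U e u (weight nu J) +
    (-1) ^+ (~~ x) * lim2 U e u (fun K => weight nu J K * digit (nu (level J)) K).
Proof.
move=> eB bu; have [C _ hC] := lim2_functionalr hU eB bu.
exact: (functional_weight_child _ _ _ hC).
Qed.

End Selection.

(** * Coefficients of the compressed multiplier *)

Section Compression.
Context {R : realType} (U : set_system nat).
Hypothesis hU : nonprincipal U.
Variables (d : dyadic -> dyadic -> R) (B : R).
Hypothesis dB : forall K L, `|d K L| <= B.
Variables (mu nu : nat -> nat) (tau : nat -> R).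

Hypothesis tauS : forall k, tau k.+1 <= tau k.
Hypothesis tau0 : tau @ \oo --> (0 : R).
Hypothesis good_nu : forall k, good_freq U (transp d) (tau k) nu mu k k k (nu k).
Hypothesis good_mu : forall k, good_freq U d (tau k) mu nu k k.+1 k.+1 (mu k).

(* The coefficients of the multiplier A D B. *)
Definition compress (I J : dyadic) : R :=
  bilin d (weight mu I) (mu (level I)) (weight nu J) (nu (level J)).

Let dB' K L : `|transp d K L| <= B. Proof. exact: dB. Qed.
Let bw rho I : bounded_fun (weight (R := R) rho I). Proof. exact: bounded_weight. Qed.

Lemma norm_signM (w : bool) (x : R) : `|(-1) ^+ w * x| = `|x|.
Proof. by rewrite normrM normr_sign mul1r. Qed.

(** Here [nu (level J)] was fixed before [mu (level I)], so both entries are close to limits in [m]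
    at the same [nu (level J)]. Two approximations and one digit term give the factor 3. *)
Lemma compress_left w I J : (level J <= level I)%N ->
  `|compress I J - compress (child w I) J| <= 3 * tau (level I).
Proof.
move=> JI; have JI1 : (level J < (level I).+1)%N by [].
have JI2 : (level J < (level I).+2)%N by exact: leqW.
have [/(_ _ JI1)[h1 h2] _ _ _] := good_mu (leqnn (level I)) (leqW JI).
have [/(_ _ JI2)[+ _] _ _ _] := good_mu (leqnn (level (child w I))) (leqW (leqW JI)).
rewrite (lim1_child hU _ _ _ _ dB (bw _ _)) => h3.
move: h2; rewrite -(norm_signM (~~ w)) => h2.
have := tauS (level I); move: h1 h2 h3; rewrite /compress !ler_norml /=; lra.
Qed.

(** The mirror image for [transp d]. The inequality is strict because [nu k] is chosen before
    [mu k]. *)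
Lemma compress_right x I J : (level I < level J)%N ->
  `|compress I J - compress I (child x J)| <= 3 * tau (level J).
Proof.
move=> IJ; have IJ1 : (level I < (level J).+1)%N by exact: leqW.
have [/(_ _ IJ)[h1 h2] _ _ _] := good_nu (leqnn (level J)) (ltnW IJ).
have [/(_ _ IJ1)[+ _] _ _ _] := good_nu (leqnn (level (child x J))) (leqW (ltnW IJ)).
rewrite (lim1_child hU _ _ _ _ dB' (bw _ _)) bilin_transp => h3.
move: h2; rewrite -(norm_signM (~~ x)) => h2; rewrite bilin_transp in h1.
have := tauS (level J); move: h1 h2 h3; rewrite /compress !ler_norml /=; lra.
Qed.

(** Idealized entries: double limits against the weights of [I] and [J], in the order of lambda for
    [lam] and in the order of mu for [mlam]. *)
Let lam I J := lim2 U d (weight mu I) (weight nu J).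
Let mlam I J := lim2 U (transp d) (weight nu J) (weight mu I).

(** At equal levels k, [mu k] comes after [nu k]: the entry is close to its limit in [m] at [nu k],
    and that limit is close to the double limit by the choice of [nu k]. *)
Lemma compress_lam I J : level I = level J ->
  `|compress I J - lam I J| <= 2 * tau (level I).
Proof.
move=> IJ; have JI : (level J <= (level I).+1)%N by rewrite IJ.
have JI1 : (level J < (level I).+1)%N by rewrite IJ.
have IJ1 : (level I <= level J)%N by rewrite IJ.
have [/(_ _ JI1)[h1 _] _ _ _] := good_mu (leqnn (level I)) JI.
have [_ h2 _ _] := good_nu (leqnn (level J)) IJ1.
by move: h1 h2; rewrite /compress /lam -IJ !ler_norml; lra.
Qed.

(** Now [nu k.+1] comes after [mu k], so the two limits are taken in the opposite order. *)
Lemma compress_mlam I J : level J = (level I).+1 ->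
  `|compress I J - mlam I J| <= 2 * tau (level I).
Proof.
move=> IJ; have JI : (level J <= (level I).+1)%N by rewrite IJ.
have IJ1 : (level I < level J)%N by rewrite IJ.
have [/(_ _ IJ1)[h1 _] _ _ _] := good_nu (leqnn (level J)) (ltnW IJ1).
have [_ h2 _ _] := good_mu (leqnn (level I)) JI.
rewrite bilin_transp IJ in h1.
by have := tauS (level I); move: h1 h2; rewrite /compress /mlam IJ !ler_norml; lra.
Qed.

(** The path goes through [lam I (child x J)], which is why the requirement on [mu k] covers [J] up
    to level [k.+1]. *)
Lemma lam_child w x I J : level I = level J ->
  `|lam I J - lam (child w I) (child x J)| <= 2 * tau (level I).
Proof.
move=> IJ; have JI : (level (child x J) <= (level I).+1)%N by rewrite IJ.
have IJ1 : (level I <= level J)%N by rewrite IJ.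
have [_ _ _] := good_mu (leqnn (level I)) JI.
rewrite -(norm_signM (~~ w)) => h1.
have [_ _ + _] := good_nu (leqnn (level J)) IJ1.
rewrite -(norm_signM (~~ x)) -{2}IJ => h2.
rewrite /lam (lim2_childl hU _ _ _ dB (bw _ _)) (lim2_childr hU _ _ _ dB (bw _ _)).
by move: h1 h2; rewrite !ler_norml; lra.
Qed.

(** The path goes through [mlam (child w I) J], at which both intervals have level [k.+1]. *)
Lemma mlam_child w x I J : level J = (level I).+1 ->
  `|mlam I J - mlam (child w I) (child x J)| <= 2 * tau (level I).
Proof.
move=> IJ; have JI : (level J <= (level I).+1)%N by rewrite IJ.
have IJ1 : (level (child w I) <= level J)%N by rewrite IJ.
have [_ _ + _] := good_mu (leqnn (level I)) JI.
rewrite -(norm_signM (~~ w)) => h1.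
have [_ _ _] := good_nu (leqnn (level J)) IJ1.
rewrite -(norm_signM (~~ x)) {2}IJ => h2.
rewrite /mlam (lim2_childl hU _ _ _ dB' (bw _ _)) (lim2_childr hU _ _ _ dB' (bw _ _)).
by have := tauS (level I); move: h1 h2; rewrite !ler_norml; lra.
Qed.

(** Each entry is within [2 * tau] of its double limit, and the two double limits are within
    [2 * tau] of each other. *)
Lemma compress_diag w x I J : level I = level J ->
  `|compress I J - compress (child w I) (child x J)| <= 6 * tau (level I).
Proof.
move=> IJ; have h1 := compress_lam IJ; have h2 := lam_child w x IJ.
have h3 : `|compress (child w I) (child x J) - lam (child w I) (child x J)| <=
    2 * tau (level I).+1 by apply: compress_lam; rewrite /= IJ.
by have := tauS (level I); move: h1 h2 h3; rewrite !ler_norml; lra.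
Qed.

Lemma compress_subdiag w x I J : level J = (level I).+1 ->
  `|compress I J - compress (child w I) (child x J)| <= 6 * tau (level I).
Proof.
move=> IJ; have h1 := compress_mlam IJ; have h2 := mlam_child w x IJ.
have h3 : `|compress (child w I) (child x J) - mlam (child w I) (child x J)| <=
    2 * tau (level I).+1 by apply: compress_mlam; rewrite /= IJ.
by have := tauS (level I); move: h1 h2 h3; rewrite !ler_norml; lra.
Qed.

Lemma lambdaE (e : dyadic -> dyadic -> R) :
  lambdaU U e = lim2 U e (fun=> 1) (fun=> 1).
Proof.
congr (lim (_ @ U)); apply/funext => j; congr (lim (_ @ U)); apply/funext => i.
rewrite /level_sum /bilin /avg mulr_sumr; apply: eq_bigr => I _.
rewrite mul1r !mulr_sumr; apply: eq_bigr => J _; rewrite mul1r /dlen; ring.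
Qed.

Lemma muE (e : dyadic -> dyadic -> R) : muU U e = lambdaU U (transp e).
Proof.
congr (lim (_ @ U)); apply/funext => j; congr (lim (_ @ U)); apply/funext => i.
rewrite /level_sum exchange_big; apply: eq_bigr => I _; apply: eq_bigr => J _.
by rewrite [dlen _ * _]mulrC.
Qed.

Lemma weight_unitE nu' : weight (R := R) nu' unit_itv = fun=> 1.
Proof. by apply/funext => K; rewrite weight_unit. Qed.

Lemma compress_unit : `|compress unit_itv unit_itv - lambdaU U d| <= 2 * tau 0.
Proof.
have := @compress_lam unit_itv unit_itv erefl.
by rewrite /lam !weight_unitE lambdaE.
Qed.

(** Levels 0 and 1 lie on the mu side of the diagonal. Beyond the error of [compress_mlam], one more
    [tau 0] pays for the digit at [nu 0] that separates the child from the root. *)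
Lemma compress_unit_child x :
  `|compress unit_itv (child x unit_itv) - muU U d| <= 3 * tau 0.
Proof.
have := @compress_mlam unit_itv (child x unit_itv) erefl.
have [_ _ _] := good_nu (I := unit_itv) (J := unit_itv) (leqnn 0) (leqnn 0).
rewrite -(norm_signM (~~ x)) muE lambdaE.
rewrite /mlam (lim2_childl hU _ _ _ dB' (bw _ _)) !weight_unitE /=.
by rewrite !ler_norml; lra.
Qed.

(** The weights average to 1 over [I] and over [J], so averaging the entries of the compression
    removes them. *)
Lemma bilin_compress i j :
  bilin compress (fun=> 1) i (fun=> 1) j = bilin d (fun=> 1) (mu i) (fun=> 1) (nu j).
Proof.
have avgw (e : dyadic -> dyadic -> R) k v rho M n :
    avg k (fun I => bilin e (weight rho I) M v n) = bilin e (fun=> 1) M v n.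
  rewrite /bilin exchange_avg; apply: eq_avg => K _.
  rewrite -[RHS]mulrC mulr1 -[RHS]mulr1 -(avg_weight rho k K) -avgZ.
  by apply: eq_avg => I _; rewrite mulrC.
transitivity (avg i (fun I => bilin d (weight mu I) (mu i) (fun=> 1) (nu j))).
  apply: eq_avg => I lI; rewrite mul1r -(bilin_transp d) -(avgw _ j _ nu).
  by apply: eq_avg => J lJ; rewrite mul1r bilin_transp /compress lI lJ.
exact: avgw.
Qed.

Lemma cvg_of_le (f : nat -> R) (l : R) n0 :
  (forall n, (n0 <= n)%N -> `|f n - l| <= tau n) -> f @ \oo --> l.
Proof.
move=> h; apply/cvgrPdist_le => e e0; move/cvgrPdist_le: tau0 => /(_ _ e0).
case=> n1 _ hn; exists (maxn n0 n1) => // n; rewrite /= geq_max => /andP[n0n n1n].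
rewrite distrC (le_trans (h _ n0n)) //.
by have := hn n n1n; rewrite /= sub0r normrN; apply: le_trans; exact: ler_norm.
Qed.

(** At the root all weights are 1, and the frequency conditions there make the level sums of [d] at
    [(mu i, nu j)] converge in the ordinary sense, first in [i >= j], then in [j]. As [tau] tends to
    0, the iterated limit is exactly that of [d]. *)
Lemma lambda_compress : lambdaU U compress = lambdaU U d.
Proof.
rewrite !lambdaE.
have h j : lim1 U compress (fun=> 1) (fun=> 1) j = lim1 U d (fun=> 1) (fun=> 1) (nu j).
  apply: (cvgn_ulim hU); apply: (@cvg_of_le _ _ j) => i ji; rewrite bilin_compress.
  have ji1 : (j < i.+1)%N by [].
  have [/(_ _ ji1)[+ _] _ _ _] := good_mu (I := unit_itv) (J := unit_itv) (leq0n i) (leq0n _).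
  by rewrite !weight_unitE.
apply: (cvgn_ulim hU); apply: (@cvg_of_le _ _ 0%N) => j _; rewrite h.
have [_ + _ _] := good_nu (I := unit_itv) (J := unit_itv) (leq0n j) (leq0n j).
by rewrite !weight_unitE.
Qed.

Lemma mu_compress : muU U compress = muU U d.
Proof.
rewrite !muE !lambdaE.
have h i : lim1 U (transp compress) (fun=> 1) (fun=> 1) i =
    lim1 U (transp d) (fun=> 1) (fun=> 1) (mu i).
  apply: (cvgn_ulim hU); apply: (@cvg_of_le _ _ i.+1) => j ij.
  rewrite bilin_transp bilin_compress -bilin_transp.
  have [/(_ _ ij)[+ _] _ _ _] := good_nu (I := unit_itv) (J := unit_itv) (leq0n j) (leq0n _).
  by rewrite !weight_unitE.
apply: (cvgn_ulim hU); apply: (@cvg_of_le _ _ 0%N) => i _; rewrite h.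
have [_ + _ _] := good_mu (I := unit_itv) (J := unit_itv) (leq0n i) (leq0n _).
by rewrite !weight_unitE.
Qed.

End Compression.

(** * Haar integrals *)

Section DyadicPoints.
Context {R : realType}.
Implicit Types (s : R) (I J K : dyadic).

Lemma dlen_gt0 I : 0 < dlen I :> R.
Proof. by rewrite invr_gt0 exprn_gt0. Qed.

Lemma ditvE I s : ditv I s <->
  (tagged I)%:R <= s * 2 ^+ level I /\ s * 2 ^+ level I < (tagged I).+1%:R.
Proof.
rewrite /ditv /= in_itv /= /dlen; split=> [/andP[]|[]].
  by rewrite ler_pdivrMr ?ltr_pdivlMr ?exprn_gt0.
by move=> h1 h2; apply/andP; rewrite ler_pdivrMr ?ltr_pdivlMr ?exprn_gt0.
Qed.

Lemma ditv_uniq s I J : level I = level J -> ditv I s -> ditv J s -> I = J.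
Proof.
case: I J => [m I] [n J] /= mn; subst n.
move=> /ditvE/= [h1 h2] /ditvE/= [h3 h4].
have h5 : (I < J.+1)%N by rewrite -(ltr_nat R) (le_lt_trans h1).
have h6 : (J < I.+1)%N by rewrite -(ltr_nat R) (le_lt_trans h3).
by congr existT; apply/val_inj/eqP; rewrite /= eqn_leq -ltnS h5.
Qed.

Lemma ditv_child I s : ditv I s <-> exists w, ditv (child w I) s.
Proof.
rewrite ditvE; split=> [[h1 h2]|[w]].
  case: (ltP (s * 2 ^+ (level I).+1) ((tagged I).*2.+1%:R)) => hm.
    exists true; apply/ditvE; rewrite /= addn0; split=> //.
    by rewrite -muln2 natrM exprS mulrCA [leLHS]mulrC ler_pM2l.
  exists false; apply/ditvE; rewrite /= addn1; split=> //.
  by rewrite -doubleS -muln2 natrM exprS mulrCA [ltRHS]mulrC ltr_pM2l.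
move=> /ditvE /=; rewrite exprS.
set t := s * _; have -> : t = s * 2 ^+ level I * 2 by rewrite /t; ring.
rewrite -mul2n; case: w => /=; rewrite -!natr1 !(natrD, natrM); lra.
Qed.

(* Arbitrary for s outside [0,1). *)
Fixpoint dyadic_at (n : nat) (s : R) : dyadic :=
  if n is n'.+1 then
    child `[< ditv (child true (dyadic_at n' s)) s >] (dyadic_at n' s)
  else unit_itv.

Lemma level_dyadic_at n s : level (dyadic_at n s) = n.
Proof. by elim: n => //= n ->. Qed.

Lemma ditv_unit s : ditv unit_itv s <-> s \in `[0, 1[.
Proof. by rewrite ditvE /= expr0 mulr1 in_itv /=; split=> [[-> ->]|/andP[]]. Qed.

Lemma dyadic_atP n s : s \in `[0, 1[ -> ditv (dyadic_at n s) s.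
Proof.
move=> s01; elim: n => [|n IH]; first exact/ditv_unit.
rewrite [dyadic_at _ _]/=; case: asboolP => // h.
by have /ditv_child[[]] := IH.
Qed.


Lemma dyadic_eq I J : level I = level J -> tagged I = tagged J :> nat -> I = J.
Proof.
by case: I J => [m I] [n J] /= mn; subst n => h; congr existT; apply/val_inj.
Qed.

Lemma child_inj w w' I J : child w I = child w' J -> w = w' /\ I = J.
Proof.
move=> h; have IJ : level I = level J by have := congr1 level h => -[].
have h2 : ((tagged I).*2 + ~~ w = (tagged J).*2 + ~~ w')%N.
  exact: (congr1 (fun K : dyadic => nat_of_ord (tagged K)) h).
have ww : w = w'.
  by move/(congr1 odd): h2; rewrite !oddD !odd_double; case: w w' {h} => [] [].
by split=> //; apply: dyadic_eq IJ _; move: h2; rewrite ww => /addIn/double_inj.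
Qed.

Lemma ditv_sub01 I s : ditv I s -> s \in `[0, 1[.
Proof.
case: I => n I /ditvE/= [h1 h2]; rewrite in_itv /=; apply/andP; split.
  by rewrite -(@pmulr_lge0 _ (2 ^+ n)) ?exprn_gt0 // (le_trans _ h1).
rewrite -(@ltr_pM2r _ (2 ^+ n)) ?exprn_gt0 // mul1r (lt_le_trans h2) //.
by rewrite -natrX ler_nat.
Qed.

Lemma ditv_at I s : ditv I s <-> (s \in `[0, 1[) /\ dyadic_at (level I) s = I.
Proof.
split=> [h|[s01 <-]]; last exact: dyadic_atP.
have s01 := ditv_sub01 h; split=> //.
by apply: (ditv_uniq _ (dyadic_atP _ s01) h); rewrite level_dyadic_at.
Qed.

Definition bit n s : bool := `[< ditv (child true (dyadic_at n s)) s >].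

Lemma dyadic_atS n s : dyadic_at n.+1 s = child (bit n s) (dyadic_at n s).
Proof. by []. Qed.

Lemma digit_dyadic_at p n s : (p < n)%N ->
  digit p (dyadic_at n s) = (-1) ^+ (~~ bit p s) :> R.
Proof.
elim: n => // n IH; rewrite ltnS leq_eqVlt dyadic_atS => /predU1P[->|pn].
  by rewrite -{1}(level_dyadic_at n s) digit_child_last.
by rewrite digit_child ?level_dyadic_at // IH.
Qed.

Lemma dyadic_at_le m n s t : (m <= n)%N -> dyadic_at n s = dyadic_at n t ->
  dyadic_at m s = dyadic_at m t.
Proof.
move=> mn; rewrite -(subnK mn) addnC; elim: (n - m)%N => [|k IH]; first by rewrite addn0.
by rewrite addnS => /child_inj[_ /IH].
Qed.

Lemma haar_funE I s : haar_fun I s =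
  if (s \in `[0, 1[) && (dyadic_at (level I) s == I)
  then (-1) ^+ (~~ bit (level I) s) else 0 :> R.
Proof.
have chE w : (s \in ditv (child w I)) =
    [&& s \in `[0%R, 1%R[, dyadic_at (level I) s == I & bit (level I) s == w].
  apply/idP/idP; rewrite inE.
    move=> /ditv_at[-> /=]; rewrite -/(bit _ s) => /child_inj[-> ->].
    by rewrite !eqxx.
  move=> /and3P[s01 /eqP h /eqP <-]; apply/ditv_at; split=> //.
  by rewrite dyadic_atS h.
rewrite /haar_fun /= !fctE /= !indicE !chE.
by case: (s \in _) => //=; case: (_ == I) => /=; rewrite ?subrr //; case: bit;
  rewrite /= ?subr0 ?sub0r ?expr0 ?expr1.
Qed.

End DyadicPoints.

Section HaarIntegrals.
Context {R : realType}.
Local Notation mu := (@lebesgue_measure R).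
Implicit Types (s t : R) (I J K L : dyadic).

(** The function of the larger interval is constant on the smaller one, so the constant is its value
    at any point there. Distinct intervals of one level are disjoint. *)
Lemma haar_mul_haar I K : I != K ->
  exists c L, forall s, haar_fun I s * haar_fun K s = c * haar_fun L s :> R.
Proof.
wlog IK : I K / (level I <= level K)%N => [hw|neIK].
  case: (leqP (level I) (level K)) => [|/ltnW] h neIK; first exact: hw.
  have [|c [L hL]] := hw K I h; first by rewrite eq_sym.
  by exists c, L => s; rewrite mulrC.
have [lIK|lIK] := eqVneq (level I) (level K).
  exists 0, I => s; rewrite !haar_funE lIK mul0r.
  case: ifP => [/andP[-> /eqP h]|_]; last by rewrite mul0r.
  by rewrite h (negbTE neIK) mulr0.
have lt : (level I < level K)%N by rewrite ltn_neqAle lIK.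
have [[s0 s0K]|/forallNP noK] := pselect (exists s : R, ditv K s); last first.
  exists 0, K => s; rewrite mul0r [haar_fun K s]haar_funE.
  case: ifP => [/andP[h1 /eqP h2]|_]; last by rewrite mulr0.
  by case: (noK s); apply/ditv_at.
exists (haar_fun I s0), K => s; rewrite [haar_fun K s]haar_funE.
case: ifP => [/andP[h1 /eqP h2]|_]; last by rewrite !mulr0.
congr (_ * _); move/ditv_at: s0K => [h3 h4].
have := dyadic_at_le lt (etrans h2 (esym h4)).
rewrite !dyadic_atS !haar_funE h1 h3 => /child_inj[-> ->].
by [].
Qed.

Lemma haar_sqr I s : haar_fun I s * haar_fun I s = \1_(ditv I) s :> R.
Proof.
rewrite haar_funE indicE.
have -> : (s \in ditv I) = (s \in `[0, 1[) && (dyadic_at (level I) s == I).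
  apply/idP/idP; first by rewrite inE => /ditv_at[-> ->]; rewrite eqxx.
  by move=> /andP[h1 /eqP h2]; rewrite inE; apply/ditv_at.
by case: ifP; rewrite ?mulr0 //= -expr2 sqrr_sign.
Qed.

Lemma measurable_ditv I : measurable (ditv I : set R).
Proof. exact: measurable_itv. Qed.

Lemma measure_ditv I : mu (ditv I) = (dlen I)%:E.
Proof.
rewrite lebesgue_measure_itv /= lte_fin ltr_pM2r ?dlen_gt0 // ltr_nat ltnSn.
by rewrite -EFinB -mulrBl -natrB ?leqnSn // subSnn mul1r.
Qed.

Let I01 : set R := [set` `[0%R, 1%R]].

Let mI01 : measurable I01. Proof. exact: measurable_itv. Qed.

Lemma integrable_indic_ditv I : mu.-integrable I01 (EFin \o \1_(ditv I)).
Proof.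
apply: (@integrableS _ _ _ mu setT I01); [exact: measurableT|exact: mI01|exact: subsetT|].
exact: integrable_indic_itv.
Qed.

Lemma Rintegral_indic_ditv I : (\int[mu]_(s in I01) \1_(ditv I) s)%R = dlen I.
Proof.
rewrite /Rintegral integral_indic //; last exact: measurable_ditv.
have -> : ditv I `&` I01 = ditv I.
  apply: setIidl => s /ditv_sub01.
  by rewrite /I01 /= !in_itv /= => /andP[-> /ltW].
have /(congr1 fine) := measure_ditv I; exact.
Qed.

Lemma integrable_haar I : mu.-integrable I01 (EFin \o (haar_fun I : R -> R)).
Proof.
have -> : EFin \o (haar_fun I : R -> R) =
    ((EFin \o (\1_(ditv (child true I)) : R -> R)) \-
     (EFin \o (\1_(ditv (child false I)) : R -> R)))%E.
  by apply/funext => s; rewrite /haar_fun /= EFinB.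
by apply: integrableB; [exact: mI01|exact: integrable_indic_ditv..].
Qed.

Lemma Rintegral_haar I : (\int[mu]_(s in I01) (haar_fun I s : R))%R = 0.
Proof.
rewrite /haar_fun /= RintegralB //; [|exact: integrable_indic_ditv|exact: integrable_indic_ditv].
by rewrite !Rintegral_indic_ditv /dlen subrr.
Qed.

Lemma integrable_haar_mul I K :
  mu.-integrable I01 (EFin \o (fun s => haar_fun I s * haar_fun K s : R)).
Proof.
have [<-|IK] := eqVneq I K.
  by under eq_fun do rewrite haar_sqr; exact: integrable_indic_ditv.
have [c [L hL]] := haar_mul_haar IK; under eq_fun do rewrite hL.
have -> : EFin \o (fun s => c * haar_fun L s) =
    (fun s => (c%:E * (EFin \o (haar_fun L : R -> R)) s)%E).
  by apply/funext => s /=; rewrite EFinM.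
exact: integrableZl (integrable_haar _).
Qed.

Lemma Rintegral_haar_mul I K :
  (\int[mu]_(s in I01) (haar_fun I s * haar_fun K s : R))%R = (I == K)%:R * dlen I.
Proof.
have [<-|IK] := eqVneq I K.
  by under eq_Rintegral do rewrite haar_sqr; rewrite Rintegral_indic_ditv mul1r.
have [c [L hL]] := haar_mul_haar IK; under eq_Rintegral do rewrite hL.
rewrite RintegralZl ?Rintegral_haar ?mulr0 ?mul0r //; exact: integrable_haar.
Qed.

Lemma Rintegral_sum (T : Type) (r : seq T) (c : T -> R) (u : T -> R -> R) :
  (forall x, mu.-integrable I01 (EFin \o u x)) ->
  mu.-integrable I01 (EFin \o (fun s => \sum_(x <- r) c x * u x s)) /\
  (\int[mu]_(s in I01) (\sum_(x <- r) c x * u x s))%R =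
  \sum_(x <- r) c x * (\int[mu]_(s in I01) u x s)%R.
Proof.
move=> iu; elim: r => [|x r [IH1 IH2]].
  have -> : (fun s => \sum_(x <- [::]) c x * u x s) = (fun=> 0).
    by apply/funext => s; rewrite big_nil.
  by rewrite big_nil Rintegral_cst // mul0r; split=> //; exact: integrable0.
rewrite big_cons -IH2.
have cu : mu.-integrable I01 (EFin \o (fun s => c x * u x s)).
  have -> : EFin \o (fun s => c x * u x s) = (fun s => ((c x)%:E * (EFin \o u x) s)%E).
    by apply/funext => s /=; rewrite EFinM.
  exact: integrableZl (iu x).
split.
  under eq_fun do rewrite big_cons.
  have -> : EFin \o (fun s => c x * u x s + \sum_(j <- r) c j * u j s) =
      (EFin \o (fun s => c x * u x s)) \+ (EFin \o (fun s => \sum_(j <- r) c j * u j s)).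
    by apply/funext => s /=; rewrite EFinD.
  exact: integrableD.
under eq_Rintegral do rewrite big_cons.
by rewrite RintegralD // RintegralZl.
Qed.

(** The variables separate in each term, so both integrals are evaluated termwise and no Fubini
    theorem is involved. *)
Lemma iterated_Rintegral_sum (T : Type) (r : seq T) (c : T -> R) (u v : T -> R -> R) :
  (forall x, mu.-integrable I01 (EFin \o u x)) ->
  (forall x, mu.-integrable I01 (EFin \o v x)) ->
  (\int[mu]_(t in I01) (\int[mu]_(s in I01) (\sum_(x <- r) c x * (u x s * v x t))))%R =
  \sum_(x <- r) c x * ((\int[mu]_(s in I01) u x s)%R * (\int[mu]_(t in I01) v x t)%R).
Proof.
move=> iu iv.
have inner t : (\int[mu]_(s in I01) (\sum_(x <- r) c x * (u x s * v x t)))%R =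
    \sum_(x <- r) (c x * (\int[mu]_(s in I01) u x s)%R) * v x t.
  have [_ h] := Rintegral_sum r (fun x => c x * v x t) iu.
  have -> : (fun s => \sum_(x <- r) c x * (u x s * v x t)) =
      (fun s => \sum_(x <- r) c x * v x t * u x s).
    by apply/funext => s; apply: eq_bigr => x _; ring.
  by rewrite h; apply: eq_bigr => x _; ring.
under eq_Rintegral do rewrite inner.
have [_ ->] := Rintegral_sum r (fun x => c x * (\int[mu]_(s in I01) u x s)%R) iv.
by apply: eq_bigr => x _; ring.
Qed.

End HaarIntegrals.

(** * The operators A and B of digit systems *)

Section InnerProduct.
Context {R : realType}.
Local Notation V2 := (V2 R).
Implicit Types (f g : V2) (I J K L : dyadic).

Definition comb (r : seq (R * (dyadic * dyadic))) : V2 :=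
  \sum_(x <- r) x.1 *: haar2 x.2.1 x.2.2.

Lemma combP f : exists r, f = comb r.
Proof.
case: f => f fV; have /asboolP[r fr] := fV; exists r; apply: val_inj.
rewrite [RHS]raddf_sum [LHS]fr; apply: eq_bigr => x _.
rewrite -[RHS]/(\val (x.1 *: haar2 x.2.1 x.2.2)) linearZ.
by [].
Qed.

Lemma val_comb r (p : R * R) : (\val (comb r) : R * R -> R) p =
  \sum_(x <- r) x.1 * (haar_fun x.2.1 p.1 * haar_fun x.2.2 p.2).
Proof.
rewrite /comb raddf_sum fct_sumE; apply: eq_bigr => x _.
by rewrite -[LHS]/((\val (x.1 *: haar2 x.2.1 x.2.2) : R * R -> R^o) p) linearZ.
Qed.

Definition gram (x y : dyadic * dyadic) : R := (x == y)%:R * (dlen x.1 * dlen x.2).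

Lemma ip_comb r r' : ip (comb r) (comb r') =
  \sum_(x <- r) \sum_(y <- r') x.1 * y.1 * gram x.2 y.2.
Proof.
rewrite /ip.
have E (s t : R) : (\val (comb r) : R * R -> R) (s, t) * (\val (comb r') : R * R -> R) (s, t) =
   \sum_(z <- [seq (x, y) | x <- r, y <- r']) (z.1.1 * z.2.1) *
     ((haar_fun z.1.2.1 s * haar_fun z.2.2.1 s) * (haar_fun z.1.2.2 t * haar_fun z.2.2.2 t)).
  rewrite !val_comb big_allpairs_dep mulr_suml; apply: eq_bigr => x _.
  by rewrite mulr_sumr; apply: eq_bigr => y _ /=; ring.
under eq_Rintegral => t _ do under eq_Rintegral => s _ do rewrite E.
rewrite iterated_Rintegral_sum; last 2 first.
- by move=> z; exact: integrable_haar_mul.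
- by move=> z; exact: integrable_haar_mul.
rewrite big_allpairs_dep; apply: eq_bigr => x _; apply: eq_bigr => y _ /=.
rewrite !Rintegral_haar_mul /gram; case: x y => [a [I J]] [b [K L]] /=.
by rewrite xpair_eqE; do 2 case: eqP => _ /=; ring.
Qed.

Lemma comb_cat r r' : comb (r ++ r') = comb r + comb r'.
Proof. by rewrite /comb big_cat. Qed.

Lemma comb_map a r : comb [seq (a * x.1, x.2) | x <- r] = a *: comb r.
Proof.
by rewrite /comb big_map scaler_sumr; apply: eq_bigr => x _; rewrite /= scalerA.
Qed.

Lemma ipC f g : ip f g = ip g f.
Proof.
have [r ->] := combP f; have [r' ->] := combP g.
rewrite !ip_comb exchange_big; apply: eq_bigr => y _; apply: eq_bigr => x _.
rewrite /gram [y.2 == _]eq_sym; case: eqP => [->|_] /=; first by ring.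
by rewrite !mul0r !mulr0.
Qed.

Lemma ip_linear f : linear (ip f : V2 -> R^o).
Proof.
move=> a g h; have [r ->] := combP f; have [s ->] := combP g; have [t ->] := combP h.
rewrite -comb_map -comb_cat !ip_comb scaler_sumr -big_split; apply: eq_bigr => x _ /=.
rewrite big_cat big_map scaler_sumr; congr (_ + _); apply: eq_bigr => y _ /=.
by rewrite /GRing.scale /=; ring.
Qed.

HB.instance Definition _ f := GRing.isLinear.Build R V2 R^o _ (ip f) (ip_linear f).

Lemma comb1 I J : haar2 I J = comb [:: (1, (I, J))].
Proof. by rewrite /comb big_seq1 scale1r. Qed.

Lemma ip_haar2 I J K L :
  ip (haar2 I J) (haar2 K L) = gram (I, J) (K, L).
Proof. by rewrite !comb1 ip_comb !big_seq1 /= !mul1r. Qed.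

Definition coef (x : dyadic * dyadic) f : R :=
  ip (haar2 x.1 x.2) f / (dlen x.1 * dlen x.2).

Lemma coef_comb x r : coef x (comb r) = \sum_(y <- r) (x == y.2)%:R * y.1.
Proof.
rewrite /coef comb1 ip_comb big_seq1 mulr_suml; apply: eq_bigr => y _.
rewrite /gram /= mul1r; case: x => I J /=; field.
by rewrite !gt_eqF // dlen_gt0.
Qed.

Lemma coef_haar2 x I J : coef x (haar2 I J) = (x == (I, J))%:R.
Proof. by rewrite comb1 coef_comb big_seq1 mulr1. Qed.

Lemma coef_linear x : linear (coef x : V2 -> R^o).
Proof.
move=> a f g; rewrite /coef linearP /= mulrDl; congr (_ + _).
by rewrite /GRing.scale /= mulrA.
Qed.

HB.instance Definition _ x := GRing.isLinear.Build R V2 R^o _ (coef x) (coef_linear x).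

End InnerProduct.

Section Operators.
Context {R : realType}.
Local Notation V2 := (V2 R).
Implicit Types (f g : V2) (I J K L : dyadic).

Lemma linear0E (V W : lmodType R) (T : V -> W) : linear T -> T 0 = 0.
Proof. by move=> linT; have := linT (-1) 0 0; rewrite scaler0 addr0 scaleN1r addNr. Qed.

Lemma linearZE (V W : lmodType R) (T : V -> W) a x : linear T -> T (a *: x) = a *: T x.
Proof. by move=> linT; have := linT a x 0; rewrite !addr0 (linear0E linT) addr0. Qed.

Lemma linearBE (V W : lmodType R) (T : V -> W) x y : linear T -> T (x - y) = T x - T y.
Proof. by move=> linT; rewrite addrC -scaleN1r linT scaleN1r addrC. Qed.

Lemma linear_comp_fun (V W X : lmodType R) (S : W -> X) (T : V -> W) :
  linear S -> linear T -> linear (fun x => S (T x)).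
Proof. by move=> linS linT c f g; rewrite linT linS. Qed.

Lemma linear_sumE (V W : lmodType R) (T : V -> W) (X : Type) (r : seq X) P (F : X -> V) :
  linear T -> T (\sum_(x <- r | P x) F x) = \sum_(x <- r | P x) T (F x).
Proof.
move=> linT; have T0 := linear0E linT.
have TD : {morph T : x y / x + y} by move=> x y; rewrite -[x]scale1r linT !scale1r.
exact: (big_morph T TD T0).
Qed.

Lemma linear_comb (W : lmodType R) (T : V2 -> W) r : linear T ->
  T (comb r) = \sum_(x <- r) x.1 *: T (haar2 x.2.1 x.2.2).
Proof.
move=> linT; rewrite /comb linear_sumE //; apply: eq_bigr => x _.
exact: linearZE.
Qed.

Lemma eq_linear_haar2 (W : lmodType R) (S T : V2 -> W) : linear S -> linear T ->
  (forall I J, S (haar2 I J) = T (haar2 I J)) -> S =1 T.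
Proof.
move=> linS linT ST f; have [r ->] := combP f; rewrite !linear_comb //.
by apply: eq_bigr => x _; rewrite ST.
Qed.

Section FiniteSums.
Variables (c : dyadic * dyadic -> V2 -> R) (e : dyadic * dyadic -> V2).

(** A sum over an infinite support defaults to 0, so linearity relies on finite supports; all three
    sums are taken over the union of the supports of [f] and [g]. *)
Lemma fsbig_linear : (forall x, linear (c x : V2 -> R^o)) ->
  (forall f, finite_set [set x | c x f != 0]) ->
  linear (fun f => \sum_(x \in [set: dyadic * dyadic]) c x f *: e x).
Proof.
move=> linc fin a f g.
pose S := [set x | c x f != 0] `|` [set x | c x g != 0].
have finS : finite_set S by rewrite finite_setU.
have red h : (forall x, c x h != 0 -> S x) ->
    \sum_(x \in [set: dyadic * dyadic]) c x h *: e x = \sum_(x <- fset_set S) c x h *: e x.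
  move=> hS; rewrite -fsbig_finite //; apply/esym/fsbig_widen => // x [_ /= nS].
  by have [->|/hS//] := eqVneq (c x h) 0; rewrite scale0r.
rewrite !red => [|x|x|x].
- rewrite scaler_sumr -big_split; apply: eq_bigr => x _ /=.
  by rewrite linc scalerDl scalerA.
- by right.
- by left.
- rewrite linc /S /=; have [->|] := eqVneq (c x f) 0; last by left.
  by rewrite scaler0 add0r; right.
Qed.

Lemma fsbig_single f x0 : (forall x, x != x0 -> c x f = 0) ->
  \sum_(x \in [set: dyadic * dyadic]) c x f *: e x = c x0 f *: e x0.
Proof.
move=> h; rewrite -(@fsbig_widen _ _ _ _ [set x0]) ?fsbig_set1 // => x [_ /= /eqP xx0].
by rewrite h // scale0r.
Qed.

End FiniteSums.

Lemma finite_level n : finite_set [set I : dyadic | (level I <= n)%N].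
Proof.
have -> : [set I : dyadic | (level I <= n)%N] =
    \bigcup_(i in `I_n.+1) (@dy i @` setT).
  apply/seteqP; split=> [[i I] /= iI|_ [i /= ilt [I _ <-]]//].
  by exists i => //; exists I.
by apply: bigcup_finite; [exact: finite_II|move=> i _; exact: finite_image].
Qed.

Lemma finite_coef f : finite_set [set x | coef x f != 0].
Proof.
have [r ->] := combP f.
apply: (@sub_finite_set _ _ [set` [seq y.2 | y <- r]]); last exact: finite_seq.
move=> x /=; apply: contra_neqT => xr; rewrite coef_comb big_seq big1 // => y yr.
case: eqP => [xy|_]; last by rewrite mul0r.
by rewrite xy map_f in xr.
Qed.

Lemma haar_mult_linear d : linear (haar_mult d : V2 -> V2).
Proof.
apply: (@fsbig_linear (fun x f => d x.1 x.2 * coef x f)) => [x a f g|f].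
  by rewrite linearP /= mulrDr mulrCA.
apply: sub_finite_set (finite_coef f) => x /=; apply: contra_neq => ->.
by rewrite mulr0.
Qed.

Lemma haar_mult_haar2 (d : dyadic -> dyadic -> R) I J :
  haar_mult d (haar2 I J) = d I J *: haar2 I J.
Proof.
rewrite /haar_mult (@fsbig_single (fun x f => d x.1 x.2 * coef x f) _ _ (I, J)).
  by rewrite coef_haar2 eqxx mulr1.
by move=> x xIJ; rewrite coef_haar2 (negbTE xIJ) mulr0.
Qed.

Lemma haar2_neq0 I J : haar2 I J != 0 :> V2.
Proof.
apply/eqP => h; have := coef_haar2 (R := R) (I, J) I J.
by rewrite h linear0 eqxx => /eqP; rewrite eq_sym oner_eq0.
Qed.

End Operators.

(** * Faithful Haar systems given by digits *)

Section FaithfulSystem.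
Context {R : realType}.
Local Notation V1 := (V1 R).
Local Notation V2 := (V2 R).
Implicit Types (I J K L : dyadic) (s : R).

(** A dyadic interval is [dyadic_at] of its left endpoint, so digits of intervals become bits of
    points. *)
Lemma digit_inj I J : level I = level J ->
  (forall l, (l < level I)%N -> digit l I = digit l J :> R) -> I = J.
Proof.
have pt K : exists s : R, K = dyadic_at (level K) s.
  exists ((tagged K)%:R * dlen K).
  suff /ditv_at[_ ->] : ditv K ((tagged K)%:R * dlen K : R) by [].
  by apply/ditvE; rewrite /dlen mulfVK ?gt_eqF ?exprn_gt0 // ltr_nat.
move=> IJ; have [s ->] := pt I; have [t ->] := pt J; rewrite !level_dyadic_at -IJ.
elim: (level I) => // n IH h.
rewrite !dyadic_atS IH => [|l ln]; last first.
  by have := h l (leqW ln); rewrite !digit_dyadic_at // leqW.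
congr child; have := h n (leqnn _); rewrite !digit_dyadic_at //.
by move/signr_inj/negb_inj.
Qed.

(* [Gam] of these sets is the set of points whose binary digits at the positions
   [mu l] are those of [I]. *)
Definition digit_set (mu : nat -> nat) I : {set 'I_(2 ^ mu (level I))} :=
  [set K | [forall l : 'I_(level I), digit (mu l) (dy K) == digit l I :> R]].

(** The sign [(-1) ^+ false] reproduces the form required by [faithful_haar] for constant signs. *)
Definition digit_system (mu : nat -> nat) I : V1 :=
  \sum_(K in digit_set mu I) (-1) ^+ false *: haar (dy K).

(** Membership in [digit_set mu I] for an interval of arbitrary level, free of the dependent
    type. *)
Definition in_digits (mu : nat -> nat) I K : bool :=
  (level K == mu (level I)) && [forall l : 'I_(level I), digit (mu l) K == digit l I :> R].


(** Strict monotonicity recovers the level of [I] from that of [K], and the digits then recover [I].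
    Hence [opA] has a single surviving term on such Haar functions. *)
Lemma in_digits_uniq mu I J K : {homo mu : i j / (i < j)%N} ->
  in_digits mu I K -> in_digits mu J K -> I = J.
Proof.
move=> hmu /andP[/eqP h1 /forallP h2] /andP[/eqP h3 /forallP h4].
have IJ : level I = level J.
  apply/eqP; rewrite eqn_leq; apply/andP; split; rewrite leqNgt; apply/negP => /hmu.
    by rewrite -h1 -h3 ltnn.
  by rewrite -h1 -h3 ltnn.
apply: (digit_inj IJ) => l lI; have lJ : (l < level J)%N by rewrite -IJ.
by rewrite -(eqP (h2 (Ordinal lI))) -(eqP (h4 (Ordinal lJ))).
Qed.

Lemma dyadic_at_dy n s : exists K : 'I_(2 ^ n), dyadic_at n s = dy K.
Proof.
by have := level_dyadic_at n s; case: dyadic_at => m K /= nE; subst n; exists K.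
Qed.

Lemma digit_systemE mu I s : (\val (digit_system mu I) : R -> R) s =
  if (s \in `[0, 1[) && in_digits mu I (dyadic_at (mu (level I)) s)
  then (-1) ^+ (~~ bit (mu (level I)) s) else 0.
Proof.
rewrite /digit_system raddf_sum fct_sumE.
under eq_bigr => K _ do rewrite expr0 scale1r /= haar_funE [level (dy K)]/=.
rewrite /in_digits level_dyadic_at eqxx /=.
case: (boolP (s \in _)) => [s01|_] /=; last by rewrite big1.
have [K KE] := dyadic_at_dy (mu (level I)) s.
rewrite KE.
have eqK (L : 'I_(2 ^ mu (level I))) : (dy K == dy L) = (L == K).
  apply/eqP/eqP => [h|->//]; apply/esym/val_inj.
  exact: (congr1 (fun K0 : dyadic => nat_of_ord (tagged K0)) h).
under eq_bigr => L _ do rewrite eqK.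
rewrite -big_mkcondr /=; case: ifPn => hK.
  rewrite (big_pred1 K) // => L; rewrite inE.
  by rewrite [pred1 _ _]/=; case: (eqVneq L K) => [->|_]; rewrite ?andbF ?hK.
rewrite big_pred0 // => L; rewrite inE.
by case: (eqVneq L K) => [->|_]; rewrite ?andbF // (negbTE hK).
Qed.

Lemma Gam_digit_set mu I s : Gam (digit_set mu I) s <->
  (s \in `[0, 1[) /\ in_digits mu I (dyadic_at (mu (level I)) s).
Proof.
rewrite /Gam /in_digits level_dyadic_at eqxx /=; split=> [[K /= hK /ditv_at/= [s01 sK]]|[s01 h]].
  by split=> //; rewrite sK; move: hK; rewrite inE.
have [K KE] := dyadic_at_dy (mu (level I)) s.
by exists K; [rewrite /= inE -KE | apply/ditv_at].
Qed.

(** The additional digit required of the child is the bit at position [mu (level I)], which is also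
    the sign of [digit_system mu I] at [s]. *)
Lemma in_digits_child mu w I s : {homo mu : i j / (i < j)%N} ->
  in_digits mu (child w I) (dyadic_at (mu (level I).+1) s) =
  in_digits mu I (dyadic_at (mu (level I)) s) && (bit (mu (level I)) s == w).
Proof.
move=> hmu; rewrite /in_digits !level_dyadic_at [level (child w I)]/= !eqxx !andTb.
have eqb (b b' : bool) : ((-1) ^+ (~~ b) == (-1) ^+ (~~ b') :> R) = (b == b').
  by apply/eqP/eqP => [/signr_inj/negb_inj|->].
have dI l n k : (l < k)%N -> (k <= n)%N ->
    (digit (mu l) (dyadic_at (mu n) s) = (-1) ^+ (~~ bit (mu l) s) :> R).
  by move=> lk kn; rewrite digit_dyadic_at // hmu // (leq_trans lk).
apply/forallP/andP => /= [h|[/forallP h /eqP <-] l].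
  split; last first.
    have := h (@Ordinal (level I).+1 (level I) (leqnn _)).
    by rewrite /= (dI _ _ _ (leqnn _) (leqnn _)) digit_child_last eqb.
  apply/forallP => l; have := h (widen_ord (leqnSn _) l).
  by rewrite /= !(dI _ _ _ (ltn_ord l)) // digit_child.
have := ltn_ord l; rewrite ltnS leq_eqVlt => /predU1P[lI|lI].
  by rewrite lI (dI _ _ _ (leqnn _) (leqnn _)) digit_child_last.
have := h (Ordinal lI); rewrite /= !(dI _ _ _ lI) // digit_child //.
Qed.

Lemma faithful_digit_system mu : {homo mu : i j / (i < j)%N} ->
  faithful_haar mu (digit_system mu).
Proof.
move=> hmu; split=> //; exists (digit_set mu), (fun _ _ => false); split=> //.
- apply/seteqP; split=> s; first by move=> /Gam_digit_set[].
  move=> s01; apply/Gam_digit_set; split=> //; rewrite /in_digits level_dyadic_at eqxx.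
  by apply/forallP; case.
- move=> I; apply/seteqP; split=> s; rewrite /= digit_systemE.
    by move=> /Gam_digit_set[-> /=]; rewrite in_digits_child // => /andP[-> /eqP ->].
  case: ifP => [/andP[s01 hs]|_ /eqP]; last by rewrite eq_sym oner_eq0.
  move=> hb; apply/Gam_digit_set; split=> //=; rewrite in_digits_child // hs /=.
  by move: hb; rewrite -[RHS](expr0 (-1)) => /(@signr_inj _ _ false); case: bit.
- move=> I; apply/seteqP; split=> s; rewrite /= digit_systemE.
    by move=> /Gam_digit_set[-> /=]; rewrite in_digits_child // => /andP[-> /eqP ->].
  case: ifP => [/andP[s01 hs]|_ /eqP]; last by rewrite eq_sym oppr_eq0 oner_eq0.
  move=> hb; apply/Gam_digit_set; split=> //=; rewrite in_digits_child // hs /=.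
  by move: hb; rewrite -[RHS](expr1 (-1)) => /(@signr_inj _ _ true); case: bit.
Qed.

End FaithfulSystem.

Section Compressed.
Context {R : realType}.
Local Notation V1 := (V1 R).
Local Notation V2 := (V2 R).
Local Notation in_digits := (in_digits (R := R)).
Local Notation digit_set := (digit_set (R := R)).
Local Notation digit_system := (digit_system (R := R)).
Implicit Types (f g : V2) (I J K L : dyadic) (d : dyadic -> dyadic -> R).

Lemma tensor_digits mu nu I J : tensor (digit_system mu I) (digit_system nu J) =
  \sum_(K in digit_set mu I) \sum_(L in digit_set nu J) haar2 (dy K) (dy L) :> V2.
Proof.
apply: val_inj; apply/funext => p.
rewrite raddf_sum fct_sumE.
rewrite -[LHS]/((\val (digit_system mu I) : R -> R) p.1 *
                (\val (digit_system nu J) : R -> R) p.2).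
rewrite /digit_system !raddf_sum !fct_sumE mulr_suml; apply: eq_bigr => K _.
rewrite raddf_sum fct_sumE mulr_sumr; apply: eq_bigr => L _.
by rewrite !expr0 !scale1r.
Qed.

Lemma ip_tensor_digits mu nu I J K L :
  ip (tensor (digit_system mu I) (digit_system nu J)) (haar2 K L) =
  (in_digits mu I K && in_digits nu J L)%:R * (dlen K * dlen L) :> R.
Proof.
have sumE rho I0 K0 : \sum_(k in digit_set rho I0) (dy k == K0)%:R =
    (in_digits rho I0 K0)%:R :> R.
  rewrite /in_digits; case: K0 => n k0; rewrite [level _]/=.
  have [nE|nE] := eqVneq n (rho (level I0)).
    subst n; rewrite andTb; have eqK (k : 'I_(2 ^ rho (level I0))) : (dy k == dy k0) = (k == k0).
      apply/eqP/eqP => [h|->//]; apply/val_inj.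
      exact: (congr1 (fun K1 : dyadic => nat_of_ord (tagged K1)) h).
    under eq_bigr => k _ do rewrite eqK.
    transitivity ((k0 \in digit_set rho I0)%:R : R); last by rewrite inE.
    have [hk|hk] := boolP (k0 \in digit_set rho I0).
      by rewrite (bigD1 k0) //= eqxx big1 ?addr0 // => k /andP[_ /negbTE ->].
    by rewrite big1 // => k hk'; case: eqP => // kk; move: hk; rewrite -kk hk'.
  rewrite andFb big1 // => k _; case: eqP => // h; move/eqP: nE.
  by case; have := congr1 level h.
rewrite ipC tensor_digits linear_sum.
under eq_bigr => k _ do rewrite linear_sum.
under eq_bigr => k _ do under eq_bigr => l _ do rewrite /= ip_haar2 /gram /= xpair_eqE
  [K == _]eq_sym [L == _]eq_sym -mulnb natrM -mulrA.
rewrite -mulnb natrM -!sumE mulr_suml mulr_suml; apply: eq_bigr => k _.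
by rewrite mulr_sumr mulr_suml; apply: eq_bigr => l _; ring.
Qed.

(** Since [n <= mu n] and [n <= nu n], intervals of level above all levels occurring in [f] give
    tensors orthogonal to [f]. *)
Lemma finite_ip_digits mu nu f : {homo mu : i j / (i < j)%N} -> {homo nu : i j / (i < j)%N} ->
  finite_set [set x : dyadic * dyadic |
    ip (tensor (digit_system mu x.1) (digit_system nu x.2)) f / (dlen x.1 * dlen x.2) != 0].
Proof.
move=> hmu hnu; have [r ->] := combP f.
have mono (rho : nat -> nat) : {homo rho : i j / (i < j)%N} -> forall n, (n <= rho n)%N.
  by move=> h; elim=> // n IH; rewrite (leq_ltn_trans IH) ?h.
pose n := (\max_(y <- r) maxn (level y.2.1) (level y.2.2))%N.
apply: (@sub_finite_set _ _
  ([set I | (level I <= n)%N] `*` [set I | (level I <= n)%N])); last first.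
  by apply: finite_setX; exact: finite_level.
move=> [I J] /=; apply: contra_neqP => /not_andP hn.
rewrite (linear_comb r (T := ip _ : V2 -> R^o)); last exact: ip_linear.
rewrite big_seq big1 ?mul0r // => y yr; rewrite ip_tensor_digits.
case: (boolP (_ && _)) => [/andP[/andP[/eqP h1 _] /andP[/eqP h2 _]]|_]; last first.
  by rewrite mul0r scaler0.
have : (maxn (level y.2.1) (level y.2.2) <= n)%N.
  by rewrite /n (big_rem y yr) leq_maxl.
rewrite geq_max h1 h2 => /andP[m1 m2]; exfalso; case: hn; apply.
  exact: leq_trans (mono _ hmu _) m1.
exact: leq_trans (mono _ hnu _) m2.
Qed.

Section Systems.
Variables (mu nu : nat -> nat).
Hypothesis hmu : {homo mu : i j / (i < j)%N}.
Hypothesis hnu : {homo nu : i j / (i < j)%N}.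
Local Notation OpA := (opA (digit_system mu) (digit_system nu)).
Local Notation OpB := (opB (digit_system mu) (digit_system nu)).

Lemma opA_linear : linear (OpA : V2 -> V2).
Proof.
apply: (fsbig_linear (c := fun x f =>
  ip (tensor (digit_system mu x.1) (digit_system nu x.2)) f / (dlen x.1 * dlen x.2))).
  move=> x a f g; rewrite linearP /= mulrDl; congr (_ + _).
  by rewrite /GRing.scale /= mulrA.
by move=> f; exact: finite_ip_digits.
Qed.

Lemma opB_linear : linear (OpB : V2 -> V2).
Proof. by apply: (fsbig_linear (c := coef)) => [x|f]; [exact: coef_linear|exact: finite_coef]. Qed.

Lemma opB_haar2 I J : OpB (haar2 I J) = tensor (digit_system mu I) (digit_system nu J).
Proof.
rewrite /opB (@fsbig_single _ coef _ _ (I, J)) ?coef_haar2 ?eqxx ?scale1r //.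
by move=> x xIJ; rewrite coef_haar2 (negbTE xIJ).
Qed.

Lemma opA_haar2 I J K L : in_digits mu I K -> in_digits nu J L ->
  OpA (haar2 K L) = ((dlen K * dlen L) / (dlen I * dlen J)) *: haar2 I J.
Proof.
move=> hI hJ.
rewrite /opA (@fsbig_single _ (fun x f =>
  ip (tensor (digit_system mu x.1) (digit_system nu x.2)) f / (dlen x.1 * dlen x.2)) _ _ (I, J)) /=.
  by rewrite ip_tensor_digits hI hJ mul1r.
move=> [I' J'] /=; rewrite ip_tensor_digits; case: (boolP (_ && _)); rewrite ?mul0r //.
by move=> /andP[h1 h2] /eqP[]; rewrite (in_digits_uniq hmu h1 hI) (in_digits_uniq hnu h2 hJ).
Qed.

(** The quotient of lengths is 2^i 2^j divided by the numbers of intervals of [K] and [L]: the value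
    of the weights on the digit sets times the normalization of the means. *)
Lemma compression_sum d I J :
  \sum_(K in digit_set mu I) \sum_(L in digit_set nu J)
    d (dy K) (dy L) *: OpA (haar2 (dy K) (dy L)) =
  compress d mu nu I J *: haar2 I J.
Proof.
transitivity ((\sum_(K in digit_set mu I) \sum_(L in digit_set nu J)
    d (dy K) (dy L) * ((dlen (dy K) * dlen (dy L)) / (dlen I * dlen J))) *: haar2 I J).
  rewrite scaler_suml; apply: eq_bigr => K hK; rewrite scaler_suml; apply: eq_bigr => L hL.
  rewrite (@opA_haar2 I J) ?scalerA // /in_digits eqxx.
    by move: hK; rewrite inE.
  by move: hL; rewrite inE.
congr (_ *: _); rewrite /compress /bilin /avg big_mkcond mulr_sumr; apply: eq_bigr => K _.
rewrite weightE inE; case: ifP => _; last by rewrite mul0r mulr0.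
rewrite !mulr_sumr big_mkcond; apply: eq_bigr => L _.
rewrite weightE inE; case: ifP => _; last by rewrite mul0r !mulr0.
rewrite /dlen /= invfM !invrK; ring.
Qed.

Lemma avg_weight_freq I : avg (mu (level I)) (weight (R := R) mu I) = 1.
Proof.
(* The digits of [I] are replaced by arbitrary coefficients and the level by any [n >= mu i], so
   that the induction can drop the last factor. *)
suff h i (c : nat -> R) n : (mu i <= n)%N ->
    avg n (fun K => \prod_(l < i) (1 + c l * digit (mu l) K)) = 1.
  exact: (h (level I) (fun l => digit l I)).
elim: i n => [|i IH] n hn.
  by rewrite -[RHS](avg_cst n); apply: eq_avg => K _; rewrite big_ord0.
have lt : (mu i < n)%N by rewrite (leq_trans _ hn) // hmu.
pose w K := \prod_(l < i) (1 + c l * digit (mu l) K).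
have wS x K : (mu i <= level K)%N -> w (child x K) = w K.
  by move=> h; apply: eq_bigr => l _; rewrite digit_child // (leq_trans _ h) // hmu.
rewrite (@avg_stable _ (mu i).+1) //; last first.
  move=> x K h; rewrite !big_ord_recr /= digit_child //; congr (_ * _).
  by apply: wS; exact: ltnW.
rewrite avgS -[RHS](IH (mu i)) //.
apply: eq_avg => K lK.
by rewrite !big_ord_recr /= -!/(w _) !wS ?lK // -lK !digit_child_last /= expr0 expr1; field.
Qed.

End Systems.

(** The composition is the compression of the multiplier with all coefficients 1, whose entries are
    means of weights. *)
Lemma opAB mu nu f : {homo mu : i j / (i < j)%N} -> {homo nu : i j / (i < j)%N} ->
  opA (digit_system mu) (digit_system nu) (opB (digit_system mu) (digit_system nu) f) = f.
Proof.
move=> hmu hnu; have linA := opA_linear hmu hnu; have linB := opB_linear mu nu.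
apply: (eq_linear_haar2 (T := id)
  (S := fun f => opA (digit_system mu) (digit_system nu)
                   (opB (digit_system mu) (digit_system nu) f))) => [|//|I J].
  exact: linear_comp_fun linA linB.
rewrite opB_haar2 tensor_digits.
rewrite (linear_sumE _ _ _ linA); under eq_bigr => K _ do rewrite (linear_sumE _ _ _ linA).
have := compression_sum hmu hnu (fun _ _ => 1) I J.
suff -> : compress (fun _ _ : dyadic => 1) mu nu I J = 1 :> R.
  rewrite scale1r => <-; apply: eq_bigr => K _; apply: eq_bigr => L _.
  by rewrite scale1r.
rewrite /compress /bilin -[RHS](avg_weight_freq hmu I); apply: eq_avg => K _.
rewrite -[RHS]mulr1; congr (_ * _); rewrite -[RHS](avg_weight_freq hnu J).
by apply: eq_avg => L _; rewrite mulr1.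
Qed.

End Compressed.

(** * Bounded operators *)

Section OperatorNorm.
Context {R : realType}.

Lemma opnorm_le (E F : Type) (p : E -> R) (q : F -> R) (T : E -> F) (M : R) :
  0 <= M -> (forall x, q (T x) <= M * p x) -> (opnorm p q T <= M%:E)%E.
Proof.
move=> M0 h; apply: ge_ereal_sup => _ [x /= px <-]; rewrite lee_fin.
by rewrite (le_trans (h x)) // -[leRHS]mulr1 ler_wpM2l.
Qed.

Lemma opnorm_ge0 (V W : lmodType R) (p : V -> R) (q : W -> R) (T : V -> W) :
  (forall a x, p (a *: x) = `|a| * p x) -> (forall a x, q (a *: x) = `|a| * q x) ->
  linear T -> (0 <= opnorm p q T)%E.
Proof.
move=> hp hq linT; apply: ereal_sup_ubound; exists 0 => /=.
  by rewrite -(scale0r 0) hp normr0 mul0r.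
by rewrite (linear0E linT) -(scale0r 0) hq normr0 mul0r.
Qed.

Lemma opnorm_bound (V W : lmodType R) (p : V -> R) (q : W -> R) (T : V -> W) (M : R) :
  (forall a x, p (a *: x) = `|a| * p x) -> (forall x, 0 <= p x) ->
  (forall x, p x = 0 -> x = 0) ->
  (forall a x, q (a *: x) = `|a| * q x) ->
  linear T -> (opnorm p q T <= M%:E)%E -> forall x, q (T x) <= M * p x.
Proof.
move=> hp p0 px0 hq linT hM x.
have [/px0 ->|px] := eqVneq (p x) 0.
  rewrite (linear0E linT) -{1}(scale0r 0) -[in leRHS](scale0r 0) hp hq.
  by rewrite normr0 !mul0r mulr0.
have pxgt : 0 < p x by rewrite lt_neqAle eq_sym px p0.
have : ((q (T ((p x)^-1 *: x)))%:E <= M%:E)%E.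
  apply: le_trans hM; apply: ereal_sup_ubound; exists ((p x)^-1 *: x) => //=.
  by rewrite hp gtr0_norm ?invr_gt0 // mulVf.
rewrite lee_fin (linearZE _ _ linT) hq gtr0_norm ?invr_gt0 // mulrC ler_pdivrMr //.
Qed.

End OperatorNorm.

Section BoundedOperators.
Context {R : realType} {Z : completeNormedModType R}.
Implicit Types (S T : Z -> Z) (z : Z) (M : R).

Local Notation nZ := (fun z : Z => `|z|).

Lemma opnorm_boundZ T M : linear T -> (opnorm nZ nZ T <= M%:E)%E ->
  forall z, `|T z| <= M * `|z|.
Proof.
apply: opnorm_bound => [a z|//|z|a z]; rewrite ?normrZ //.
by move=> /eqP; rewrite normr_eq0 => /eqP.
Qed.

Lemma opnorm_ge0Z T : linear T -> (0 <= opnorm nZ nZ T)%E.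
Proof. by apply: opnorm_ge0 => a z; rewrite normrZ. Qed.

Lemma bounded_opP T : bounded_op T <->
  linear T /\ exists2 M, 0 <= M & forall z, `|T z| <= M * `|z|.
Proof.
split=> [[linT fin]|[linT [M M0 h]]]; split=> //; last first.
  by apply: le_lt_trans (ltry M); exact: opnorm_le.
have T0 := opnorm_ge0Z linT.
have fnum : opnorm nZ nZ T \is a fin_num by rewrite ge0_fin_numE.
exists (fine (opnorm nZ nZ T)); first exact: fine_ge0.
by apply: opnorm_boundZ => //; rewrite fineK.
Qed.

Lemma bounded_op_id : bounded_op (@id Z).
Proof. by apply/bounded_opP; split=> //; exists 1 => // z; rewrite mul1r. Qed.

Lemma bounded_op_comp S T : bounded_op S -> bounded_op T -> bounded_op (S \o T).
Proof.
move=> /bounded_opP[linS [M M0 hS]] /bounded_opP[linT [M' M'0 hT]].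
apply/bounded_opP; split=> [a x y|]; first by rewrite /= linT linS.
exists (M * M') => [|z]; first exact: mulr_ge0.
by rewrite (le_trans (hS _)) // -mulrA ler_wpM2l.
Qed.

Lemma bounded_op_lin a S T : bounded_op S -> bounded_op T ->
  bounded_op (fun z => a *: S z + T z).
Proof.
move=> /bounded_opP[linS [M M0 hS]] /bounded_opP[linT [M' M'0 hT]].
apply/bounded_opP; split=> [b x y|].
  by rewrite linT linS !scalerDr !scalerA addrACA [b * a]mulrC.
exists (`|a| * M + M') => [|z]; first by rewrite addr_ge0 // mulr_ge0.
rewrite (le_trans (ler_normD _ _)) // mulrDl lerD // normrZ -mulrA ler_wpM2l //.
Qed.

Lemma bounded_op_sub S T : bounded_op S -> bounded_op T ->
  bounded_op (fun z => S z - T z).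
Proof.
move=> hS hT; have -> : (fun z => S z - T z) = (fun z => -1 *: T z + S z).
  by apply/funext => z; rewrite scaleN1r addrC.
exact: bounded_op_lin.
Qed.

(* Neumann: y is the fixed point of the contraction z |-> y + (z - T z). *)
Lemma near_id_invertible T : bounded_op T -> (forall z, `|z - T z| <= 2^-1 * `|z|) ->
  exists2 T', bounded_op T' & T' \o T = id.
Proof.
move=> /bounded_opP[linT _] hT.
have linB : linear (fun z => z - T z).
  by move=> a x y; rewrite linT scalerBr opprD addrACA.
have TB x y : T (x - y) = T x - T y by exact: linearBE.
have low z : `|z| <= 2 * `|T z|.
  have := hT z; have := lerB_dist z (T z); lra.
have inj x y : T x = T y -> x = y.
  move=> Txy; apply/eqP; rewrite -subr_eq0 -normr_le0 (le_trans (low _)) //.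
  by rewrite TB Txy subrr normr0 mulr0.
have surj y : exists x, T x = y.
  pose f : Z -> Z := fun z => y + (z - T z).
  have ctr : is_contraction (totalfun_ [set: Z] f).
    exists (2^-1)%:nng; split=> /=; first by rewrite invf_lt1 ?ltr1n.
    move=> [u v] _ /=.
    have -> : f u - f v = (u - v) - T (u - v).
      by rewrite /f opprD addrACA subrr add0r opprD opprK addrACA TB opprB [- T u + _]addrC.
    exact: hT.
  have [||x _ /= xE] := banach_fixed_point ctr; [exact: closedT|by exists 0|].
  exists x; rewrite -[LHS](subKr x) {1}xE; exact: addrK.
have /choice[T' hT'] := surj.
exists T'; last by apply/funext => z; apply: inj; rewrite /= hT'.
apply/bounded_opP; split=> [a x y|].
  by apply: inj; rewrite linT !hT'.
by exists 2 => // z; have := low (T' z); rewrite hT'.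
Qed.

Section Density.
Context {V : lmodType R} (iota : {linear V -> Z}).
Hypothesis iota_dense : dense (range iota).

Lemma dense_approx z e : 0 < e -> exists f, `|z - iota f| < e.
Proof.
move=> e0; have [|y [/= zy [f _ fy]]] := iota_dense (O := ball z e) _ (ball_open z e).
  by exists z; exact: ballxx.
by exists f; rewrite fy; move: zy; rewrite -ball_normE.
Qed.

Lemma bound_dense T M : bounded_op T ->
  (forall f, `|T (iota f)| <= M * `|iota f|) -> forall z, `|T z| <= M * `|z|.
Proof.
move=> /bounded_opP[linT [K K0 hK]] hM z; apply/ler_addgt0Pr => e e0.
have TB x y : T (x - y) = T x - T y by exact: linearBE.
(* Approximation within [e / c] costs [K * (e / c)] in [T] and at most [|M| * (e / c)] on the
   right-hand side. *)
pose c := 1 + K + `|M|; have c0 : 0 < c by rewrite /c; have := normr_ge0 M; lra.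
have [f hf] := dense_approx z (divr_gt0 e0 c0).
have h1 : `|T z - T (iota f)| <= K * (e / c).
  by rewrite -TB (le_trans (hK _)) // ler_wpM2l // ltW.
have h2 : `|M * `|iota f| - M * `|z| | <= `|M| * (e / c).
  rewrite -mulrBr normrM ler_wpM2l // distrC (le_trans (ler_dist_dist _ _)) // ltW //.
have h3 := hM f; have h4 := lerB_dist (T z) (T (iota f)).
have h5 : K * (e / c) + `|M| * (e / c) <= e.
  rewrite -mulrDl mulrA ler_pdivrMr // mulrC ler_wpM2l ?ltW // /c; lra.
move: h2; rewrite ler_norml => /andP[_ h2]; lra.
Qed.

Lemma eq_dense S T : bounded_op S -> bounded_op T ->
  (forall f, S (iota f) = T (iota f)) -> S = T.
Proof.
move=> hS hT ST; apply/funext => z; apply/eqP; rewrite -subr_eq0 -normr_le0.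
rewrite -(mul0r `|z|); apply: (bound_dense (T := fun z => S z - T z)) => [|f].
  exact: bounded_op_sub.
by rewrite ST subrr normr0 mul0r.
Qed.

Lemma extend_dense (q : V -> Z) M : linear q -> 0 <= M ->
  (forall f, `|q f| <= M * `|iota f|) ->
  exists T, [/\ linear T, forall f, T (iota f) = q f & forall z, `|T z| <= M * `|z|].
Proof.
move=> linq M0 hq.
have qB x y : q (x - y) = q x - q y by exact: linearBE.
have hqB f g : `|q f - q g| <= M * `|iota f - iota g|.
  by rewrite -qB -linearB.
have [r [r0 invn]] : exists r : nat -> R, (forall n, 0 < r n) /\
    forall e, 0 < e -> exists n0, forall n, (n0 <= n)%N -> r n <= e.
  exists (fun n => n.+1%:R^-1); split=> [n|e e0]; first by rewrite invr_gt0.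
  have := near_infty_natSinv_lt (PosNum e0).
  by case=> n0 _ h; exists n0 => n /h /= /ltW.
have /choice[a ha] : forall zn : Z * nat, exists f, `|zn.1 - iota f| < r zn.2.
  by move=> [z n]; exact: dense_approx.
pose u z n := q (a (z, n)).
have est z g n : `|u z n - q g| <= M * (`|z - iota g| + r n).
  apply: le_trans (hqB _ _) _; rewrite ler_wpM2l //.
  apply: le_trans (ler_distD z _ _) _.
  by rewrite [leRHS]addrC lerD2r distrC; apply/ltW/(ha (z, n)).
have cvgu z : cvgn (u z).
  apply: cauchy_cvg; apply: cauchy_exP => e e0.
  have M1 : 0 < 2 * M + 1 by lra.
  have [n0 hn0] := invn _ (divr_gt0 e0 M1).
  exists (u z n0); exists n0 => // n /= n0n; rewrite -ball_normE /= distrC.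
  apply: le_lt_trans (est z (a (z, n0)) n) _.
  have h1 := hn0 _ n0n; have h2 := ha (z, n0); rewrite /= in h2.
  have h3 := hn0 _ (leqnn n0).
  have h4 : M * (`|z - iota (a (z, n0))| + r n) <= M * (2 * (e / (2 * M + 1))).
    by rewrite ler_wpM2l //; lra.
  apply: (le_lt_trans h4); rewrite !mulrA ltr_pdivrMr // [M * 2]mulrC; nra.
pose T z := limn (u z).
(* This estimate, uniform in [g], shows that the limit does not depend on the approximating
   sequence. Linearity, extension and the bound all follow from it. *)
have key z g : `|T z - q g| <= M * `|z - iota g|.
  apply/ler_addgt0Pr => e e0.
  have M1 : 0 < M + 1 by lra.
  have e1 := divr_gt0 e0 M1.
  have /cvgrPdist_le/(_ _ e1)[n1 _ h1] := cvgu z.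
  have [n0 hn0] := invn _ e1.
  have := h1 (maxn n0 n1) (leq_maxr _ _); have := hn0 (maxn n0 n1) (leq_maxl _ _).
  have := est z g (maxn n0 n1); move: (maxn n0 n1) => n h2 h3 h4.
  have := ler_distD (u z n) (T z) (q g).
  have : M * (r n) <= M * (e / (M + 1)) by rewrite ler_wpM2l.
  have : M * (e / (M + 1)) + e / (M + 1) = e by field; lra.
  rewrite /= in h4; rewrite mulrDr in h2; lra.
exists T; split.
- move=> b x y; apply/eqP; rewrite -subr_eq0 -normr_le0; apply/ler_addgt0Pr => e e0.
  rewrite add0r; pose c := 2 * M * (`|b| + 1) + 1.
  have c0 : 0 < c by rewrite /c; have := normr_ge0 b; nra.
  have [g hg] := dense_approx x (divr_gt0 e0 c0).
  have [h hh] := dense_approx y (divr_gt0 e0 c0).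
  have k1 := key (b *: x + y) (b *: g + h).
  have k2 := key x g; have k3 := key y h.
  have n1 : `|b *: x + y - iota (b *: g + h)| <= (`|b| + 1) * (e / c).
    rewrite linearP opprD addrACA -scalerBr (le_trans (ler_normD _ _)) //.
    by rewrite normrZ mulrDl mul1r lerD ?(ltW hh) // ler_wpM2l // ltW.
  have -> : T (b *: x + y) - (b *: T x + T y) = (T (b *: x + y) - q (b *: g + h))
      - (b *: (T x - q g) + (T y - q h)).
    by rewrite linq scalerBr addrACA -[- (b *: q g) - _]opprD opprB addrA subrK.
  have k4 : `|b *: (T x - q g) + (T y - q h)| <= (`|b| + 1) * (M * (e / c)).
    rewrite (le_trans (ler_normD _ _)) // normrZ mulrDl mul1r lerD //.
      by rewrite ler_wpM2l // (le_trans k2) // ler_wpM2l // ltW.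
    by rewrite (le_trans k3) // ler_wpM2l // ltW.
  have k5 : M * `|b *: x + y - iota (b *: g + h)| <= M * ((`|b| + 1) * (e / c)).
    by rewrite ler_wpM2l.
  have := ler_normB (T (b *: x + y) - q (b *: g + h)) (b *: (T x - q g) + (T y - q h)).
  have k6 : 2 * M * (`|b| + 1) * (e / c) <= e.
    rewrite mulrA ler_pdivrMr // mulrC ler_wpM2l ?ltW // /c; lra.
  move: k1 k4 k5 k6; set X := e / c; move=> k1 k4 k5 k6 k7.
  lra.
- move=> f; apply/eqP; rewrite -subr_eq0 -normr_le0 (le_trans (key _ _)) //.
  by rewrite subrr normr0 mulr0.
- move=> z; have q0 : q 0 = 0 := linear0E linq.
  have i0 : iota 0 = 0 := linear0 iota.
  by have := key z 0; rewrite q0 i0 !subr0.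
Qed.

End Density.

End BoundedOperators.

(** * Variation norm and Capon combinations *)

Section VariationNorm.
Context {R : realType}.
Implicit Types (e : dyadic -> dyadic -> R) (b : nat -> R) (c : R).

Lemma bigmax_le (I : finType) (F : I -> R) c :
  0 <= c -> (forall i, F i <= c) -> \big[Num.max/0]_(i : I) F i <= c.
Proof. by move=> c0 h; apply: (big_ind (fun x => x <= c)) => // x y; rewrite ge_max => -> ->. Qed.

Lemma bigmax_ge0 (I : finType) (F : I -> R) : 0 <= \big[Num.max/0]_(i : I) F i.
Proof.
rewrite unlock /reducebig; elim: (index_enum I) => //= i r IH.
by rewrite le_max IH orbT.
Qed.

Lemma dyadic_series_le b c : 0 <= c -> (forall k, 0 <= b k) ->
  (forall k, b k <= c * 2^-1 ^+ k.+1) -> (\sum_(0 <= k <oo) (b k)%:E <= c%:E)%E.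
Proof.
move=> c0 b0 bc; apply: lime_le; first by apply: is_cvg_nneseries => k _ _; rewrite lee_fin.
near=> n; rewrite sumEFin lee_fin.
suff : \sum_(0 <= k < n) b k <= c * (1 - 2^-1 ^+ n).
  move/le_trans; apply; rewrite -[leRHS]mulr1 ler_wpM2l // gerBl exprn_ge0 //.
elim: (n) => [|m IH]; first by rewrite big_geq // expr0 subrr mulr0.
rewrite big_nat_recr //= (le_trans (lerD IH (bc m))) // -mulrDr ler_wpM2l // exprS; lra.
Unshelve. all: by end_near. Qed.

(** The factor 1 / (k + 1) in [tau] cancels the weight k + 1 of the first two sums and the k + 1
    inner terms of the last two, leaving four geometric series of sum at most [c]. *)
Lemma T2S_norm_le e c : 0 <= c ->
  let tau k := c / k.+1%:R * 2^-1 ^+ k.+1 in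
  (forall I J w x, level I = level J ->
     `|e I J - e (child w I) (child x J)| <= tau (level I)) ->
  (forall I J w x, level J = (level I).+1 ->
     `|e I J - e (child w I) (child x J)| <= tau (level I)) ->
  (forall I J w, (level J <= level I)%N -> `|e I J - e (child w I) J| <= tau (level I)) ->
  (forall I J x j, level J = j.+1 -> (level I <= j)%N -> `|e I J - e I (child x J)| <= tau j) ->
  (T2S_norm e <= (4 * c)%:E)%E.
Proof.
move=> c0 tau h1 h2 h3 h4.
have tau0 k : 0 <= tau k by rewrite /tau mulr_ge0 ?exprn_ge0 ?divr_ge0.
have tauk k v : v <= tau k -> k.+1%:R * v <= c * 2^-1 ^+ k.+1.
  move=> hv; apply: (le_trans (ler_wpM2l _ hv)) => //.
  by rewrite /tau mulrA mulrCA divff ?mulr1 // mulr1.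
have -> : (4 * c)%:E = (c%:E + c%:E + c%:E + c%:E)%E.
  by rewrite -!EFinD; congr EFin; ring.
rewrite /T2S_norm; apply: leeD; first apply: leeD; first apply: leeD.
- apply: dyadic_series_le => // k.
    by rewrite mulr_ge0 // /var2; exact: bigmax_ge0.
  by apply: tauk; do 4 (apply: bigmax_le => // ?); exact: h1.
- apply: dyadic_series_le => // k.
    by rewrite mulr_ge0 // /var2; exact: bigmax_ge0.
  by apply: tauk; do 4 (apply: bigmax_le => // ?); exact: h2.
- apply: dyadic_series_le => // i.
    by apply: sumr_ge0 => j _; exact: bigmax_ge0.
  apply: le_trans (tauk i _ (lexx _)).
  apply: (@le_trans _ _ (\sum_(0 <= j < i.+1) tau i)).
    rewrite big_nat [leRHS]big_nat; apply: ler_sum => j /andP[_ ji].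
    by do 3 (apply: bigmax_le => // ?); apply: h3.
  by rewrite sumr_const_nat subn0 mulr_natl.
- apply: dyadic_series_le => // j.
    by apply: sumr_ge0 => i _; exact: bigmax_ge0.
  apply: le_trans (tauk j _ (lexx _)).
  apply: (@le_trans _ _ (\sum_(0 <= i < j.+1) tau j)).
    rewrite big_nat [leRHS]big_nat; apply: ler_sum => i /andP[_ ij].
    by do 3 (apply: bigmax_le => // ?); apply: h4.
  by rewrite sumr_const_nat subn0 mulr_natl.
Qed.

End VariationNorm.

Section Multipliers.
Context {R : realType} (U : set_system nat).
Hypothesis hU : nonprincipal U.
Implicit Types (d e : dyadic -> dyadic -> R).

Definition bounded_coefs d := exists B, forall I J, `|d I J| <= B.

Lemma lambda_linear a d e : bounded_coefs d -> bounded_coefs e ->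
  lambdaU U (fun I J => a * d I J + e I J) = a * lambdaU U d + lambdaU U e.
Proof.
move=> [B dB] [B' eB']; rewrite !lambdaE.
have b1 : bounded_fun (fun=> 1 : R) := bounded_fun_cst 1.
have [c hc] := bilin_bounded dB b1 b1; have [c' hc'] := bilin_bounded eB' b1 b1.
have [k hk] := lim1_bounded hU dB b1 b1; have [k' hk'] := lim1_bounded hU eB' b1 b1.
rewrite /lim2 -(ulimZ hU a hk) -(ulimD hU (c := Num.max (`|a| * k) k')).
- congr (ulim U _); apply/funext => n; rewrite /lim1.
  rewrite -(ulimZ hU a (hc^~ n)) -(ulimD hU (c := Num.max (`|a| * c) c')).
  + congr (ulim U _); apply/funext => m.
    rewrite /bilin -avgZ -avgD; apply: eq_avg => K _; rewrite !mul1r -avgZ -avgD.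
    by apply: eq_avg => L _; rewrite !mul1r.
  + by move=> m; rewrite le_max normrM ler_wpM2l.
  + by move=> m; rewrite le_max hc' orbT.
- by move=> m; rewrite le_max normrM ler_wpM2l.
- by move=> m; rewrite le_max hk' orbT.
Qed.

Lemma mu_linear a d e : bounded_coefs d -> bounded_coefs e ->
  muU U (fun I J => a * d I J + e I J) = a * muU U d + muU U e.
Proof.
move=> [B dB] [B' eB']; rewrite !muE; apply: lambda_linear.
  by exists B => I J; exact: dB.
by exists B' => I J; exact: eB'.
Qed.

(** For fixed [j] the inner index eventually exceeds [j], so lambda sees only one side of the
    diagonal. *)
Lemma lambda_eventually d l :
  (forall I J, (level J <= level I)%N -> d I J = l) -> lambdaU U d = l.
Proof.
move=> h; rewrite lambdaE.
have h1 j : lim1 U d (fun=> 1) (fun=> 1) j = l.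
  apply: (cvgn_ulim hU); apply: cvg_near_cst; exists j => // i /= ji.
  rewrite /bilin -[RHS](avg_cst i); apply: eq_avg => K lK; rewrite mul1r -[RHS](avg_cst j).
  by apply: eq_avg => L lL; rewrite mul1r h // lK lL.
by rewrite /lim2; under [X in ulim U X]eq_fun do rewrite h1; exact: ulim_cst.
Qed.

Lemma mu_eventually d l :
  (forall I J, (level I < level J)%N -> d I J = l) -> muU U d = l.
Proof.
move=> h; rewrite muE lambdaE.
have h1 i : lim1 U (transp d) (fun=> 1) (fun=> 1) i = l.
  apply: (cvgn_ulim hU); apply: cvg_near_cst; exists i.+1 => // j /= ij.
  rewrite bilin_transp /bilin -[RHS](avg_cst i); apply: eq_avg => K lK.
  rewrite mul1r -[RHS](avg_cst j).
  by apply: eq_avg => L lL; rewrite mul1r h // lK lL.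
by rewrite /lim2; under [X in ulim U X]eq_fun do rewrite h1; exact: ulim_cst.
Qed.

(** Larger level means smaller interval: the test is |I| <= |J|. *)
Definition capon_coef (a b : R) (I J : dyadic) : R :=
  if (level J <= level I)%N then a else b.

Lemma lambda_capon_coef a b : lambdaU U (capon_coef a b) = a.
Proof. by apply: lambda_eventually => I J h; rewrite /capon_coef h. Qed.

Lemma mu_capon_coef a b : muU U (capon_coef a b) = b.
Proof. by apply: mu_eventually => I J h; rewrite /capon_coef leqNgt h. Qed.

Lemma capon_coef_bounded a b : bounded_coefs (capon_coef a b).
Proof.
by exists (Num.max `|a| `|b|) => I J; rewrite /capon_coef le_max; case: ifP; rewrite lexx ?orbT.
Qed.

End Multipliers.

Section CaponComb.
Context {R : realType}.

Lemma dlen_le I J : (dlen I <= dlen J :> R) = (level J <= level I)%N.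
Proof. by rewrite /dlen lef_pV2 ?posrE ?exprn_gt0 // ler_eXn2l // ltr1n. Qed.

Lemma capon_linear : linear (@capon R).
Proof. exact: haar_mult_linear. Qed.

Lemma linear_comb_compl (V : lmodType R) (T : V -> V) a b : linear T ->
  linear (fun f => a *: T f + b *: (f - T f)).
Proof.
move=> linT c f g; rewrite linT opprD addrACA -scalerBr !scalerDr !scalerA.
by rewrite [a * c]mulrC [b * c]mulrC -addrACA.
Qed.

Lemma capon_comb_linear a b : linear (@capon_comb R a b).
Proof. exact: linear_comb_compl capon_linear. Qed.

Lemma capon_comb_haar2 a b I J :
  @capon_comb R a b (haar2 I J) = capon_coef a b I J *: haar2 I J.
Proof.
rewrite /capon_comb /capon haar_mult_haar2 dlen_le /capon_coef.
case: ifP => _; first by rewrite scale1r subrr scaler0 addr0.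
by rewrite scale0r scaler0 add0r subr0.
Qed.

Lemma capon_comb_comp a b a' b' f :
  capon_comb a b (capon_comb a' b' f) = @capon_comb R (a * a') (b * b') f.
Proof.
apply: (eq_linear_haar2 (S := fun f => capon_comb a b (capon_comb a' b' f))
  (T := capon_comb (a * a') (b * b'))) => [||I J].
- exact: linear_comp_fun (capon_comb_linear _ _) (capon_comb_linear _ _).
- exact: capon_comb_linear.
rewrite [in LHS]capon_comb_haar2 [RHS]capon_comb_haar2.
rewrite (linearZE _ _ (capon_comb_linear a b)) capon_comb_haar2 scalerA mulrC.
by rewrite /capon_coef; case: ifP.
Qed.

End CaponComb.

(** * Factorization *)

Section CaponSpace.
Context {R : realType}.
Variables (C : R) (N : V2 R -> R) (Z : completeNormedModType R).
Variable iota : {linear V2 R -> Z}.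
Hypotheses (hN : is_norm N) (hZ : is_completion N iota).
Hypothesis hCapon : capon_space C N iota.

Local Notation nZ := (fun z : Z => `|z|).

Let N_iota f : N f = `|iota f|. Proof. by rewrite hZ.1. Qed.
Let iota_dense : dense (range iota) := hZ.2.
Let NZ a f : N (a *: f) = `|a| * N f. Proof. by case: hN. Qed.
Let N0 f : N f = 0 -> f = 0. Proof. by case: hN => _ _; exact. Qed.
Let N_ge0 f : 0 <= N f. Proof. by rewrite N_iota. Qed.

Lemma opnormN_bound (T : V2 R -> Z) M : linear T -> (opnorm N nZ T <= M%:E)%E ->
  forall f, `|T f| <= M * `|iota f|.
Proof.
move=> linT hM f; rewrite -N_iota.
by apply: (opnorm_bound NZ N_ge0 N0 (q := nZ)) => // a z; rewrite normrZ.
Qed.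

Lemma opnormNN_fin (T : V2 R -> V2 R) : linear T -> (opnorm N N T < +oo)%E ->
  exists2 M, 0 <= M & opnorm N N T = M%:E.
Proof.
move=> linT fin; have T0 := opnorm_ge0 NZ NZ linT.
exists (fine (opnorm N N T)); first exact: fine_ge0.
by rewrite fineK // ge0_fin_numE.
Qed.

Lemma extend_bounded (T : V2 R -> V2 R) M : linear T -> 0 <= M -> opnorm N N T = M%:E ->
  exists T' : Z -> Z, [/\ bounded_op T', forall f, T' (iota f) = iota (T f) &
    (opnorm nZ nZ T' <= opnorm N N T)%E].
Proof.
move=> linT M0 hM.
have [||T' [linT' TE Tb]] := extend_dense iota_dense (q := fun f => iota (T f)) (M := M) _ M0.
- by move=> a f g; rewrite linT linearP.
- move=> f; rewrite -!N_iota; apply: (opnorm_bound NZ N_ge0 N0 NZ linT).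
  by rewrite hM.
exists T'; split=> //; first by apply/bounded_opP; split=> //; exists M.
by rewrite hM; exact: opnorm_le.
Qed.

Lemma bounded_multiplier_coefs (D : Z -> Z) d :
  bounded_haar_mult iota D d -> bounded_coefs d.
Proof.
move=> [/bounded_opP[linD [M M0 hM]] hD]; exists M => I J.
have h0 : 0 < `|iota (haar2 I J)|.
  rewrite -N_iota lt_neqAle N_ge0 andbT eq_sym; apply/eqP => /N0/eqP.
  by rewrite (negbTE (haar2_neq0 _ _)).
by have := hM (iota (haar2 I J)); rewrite hD normrZ ler_pM2r.
Qed.

Lemma multiplierE (D : Z -> Z) d f : linear D ->
  (forall I J, D (iota (haar2 I J)) = d I J *: iota (haar2 I J)) ->
  D (iota f) = iota (haar_mult d f).
Proof.
move=> linD hD; apply: (eq_linear_haar2 (S := fun f => D (iota f))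
  (T := fun f => iota (haar_mult d f))).
- by move=> a g h; rewrite linearP linD.
- by move=> a g h; rewrite haar_mult_linear linearP.
- by move=> I J; rewrite hD haar_mult_haar2 linearZ.
Qed.

Lemma compression_exists (U : set_system nat) (D : Z -> Z) d eps : nonprincipal U ->
  bounded_haar_mult iota D d -> 0 < eps ->
  exists (A B : Z -> Z) (e : dyadic -> dyadic -> R),
    [/\ bounded_op A /\ bounded_op B,
        (opnorm nZ nZ A * opnorm nZ nZ B <= C%:E)%E /\ A \o B = id,
        bounded_haar_mult iota (A \o D \o B) e,
        lambdaU U e = lambdaU U d /\ muU U e = muU U d &
        [/\ (T2S_norm e <= eps%:E)%E, `|e unit_itv unit_itv - lambdaU U d| <= eps &
            forall x, `|e unit_itv (child x unit_itv) - muU U d| <= eps]].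
Proof.
move=> hU hD eps0; have [bD DE] := hD; have [linD _] := bD.
have [B0 dB] := bounded_multiplier_coefs hD.
(* The differences of entries are at most [6 * tau k], and [T2S_norm_le] with constant [eps / 4]
   then yields [eps]. *)
pose tau k : R := (eps / 4 / k.+1%:R * 2^-1 ^+ k.+1) / 6.
have eps_ge0 := ltW eps0.
have tau_gt0 k : 0 < tau k.
  by rewrite /tau !divr_gt0 // mulr_gt0 ?exprn_gt0 ?divr_gt0 // invr_gt0.
have tauS k : tau k.+1 <= tau k.
  rewrite /tau ler_pM2r ?invr_gt0 // ler_pM ?exprn_ge0 ?divr_ge0 //.
    by rewrite ler_pM2l ?divr_gt0 // lef_pV2 ?posrE // ler_nat.
  rewrite [leLHS]exprS ler_piMl ?exprn_ge0 //; lra.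
have tau_half k : tau k <= eps / 24 * 2^-1 ^+ k.
  rewrite /tau exprS.
  have : eps / 4 / k.+1%:R <= eps / 4.
    by rewrite ler_piMr ?divr_ge0 // invf_le1 // ler1n.
  have : 0 <= 2^-1 ^+ k :> R by rewrite exprn_ge0.
  move: (2^-1 ^+ k) (eps / 4 / k.+1%:R) => p q p0 hq; nra.
have tau_0 : tau @ \oo --> (0 : R).
  apply: (@squeeze_cvgr _ _ _ _ (fun=> 0) (fun k => eps / 24 * 2^-1 ^+ k)).
  - by near=> k; rewrite ltW //= tau_half.
  - exact: cvg_cst.
  - rewrite -(mulr0 (eps / 24)); apply: cvgMr; apply: cvg_expr.
    by rewrite ger0_norm // invf_lt1 // ltr1n.
have [mu [nu [hmu hnu gnu gmu]]] := select_frequencies hU dB tau_gt0.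
pose A0 := opA (digit_system (R := R) mu) (digit_system nu).
pose Bo := opB (digit_system (R := R) mu) (digit_system nu).
have linA : linear A0 by exact: opA_linear.
have linB : linear Bo by exact: opB_linear.
have AB f : A0 (Bo f) = f by exact: opAB.
have := hCapon.1 _ _ _ _ (faithful_digit_system hmu) (faithful_digit_system hnu).
rewrite -/A0 -/Bo => normAB.
have A_ge0 := opnorm_ge0 NZ NZ linA; have B_ge0 := opnorm_ge0 NZ NZ linB.
pose h0 : V2 R := haar2 unit_itv unit_itv.
have h0n : N h0 != 0 by apply/eqP => /N0/eqP; rewrite (negbTE (haar2_neq0 _ _)).
(* In the extended reals 0 times infinity is 0, so a finite product bounds both factors only once
   neither vanishes; this follows from [AB] at the nonzero vector [h0]. *)
have A_neq0 : opnorm N N A0 != 0%E.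
  apply/eqP => A00; have := opnorm_bound NZ N_ge0 N0 NZ linA (M := 0).
  rewrite A00 lexx => /(_ isT (Bo h0)); rewrite AB mul0r => h.
  by move: h0n; rewrite eq_le h N_ge0.
have B_neq0 : opnorm N N Bo != 0%E.
  apply/eqP => B00; have := opnorm_bound NZ N_ge0 N0 NZ linB (M := 0).
  rewrite B00 lexx => /(_ isT h0); rewrite mul0r => h.
  have /N0 Bh : N (Bo h0) = 0 by apply/eqP; rewrite eq_le h N_ge0.
  by move: h0n; rewrite -(AB h0) Bh (linear0E linA) -(scale0r h0) NZ normr0 mul0r eqxx.
have A_gt0 : (0 < opnorm N N A0)%E by rewrite lt_neqAle eq_sym A_neq0.
have B_gt0 : (0 < opnorm N N Bo)%E by rewrite lt_neqAle eq_sym B_neq0.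
have [MA MA0 hMA] : exists2 M, 0 <= M & opnorm N N A0 = M%:E.
  apply: opnormNN_fin => //; rewrite ltey; apply/eqP => Ay.
  by move: normAB; rewrite Ay gt0_mulye // leye_eq.
have [MB MB0 hMB] : exists2 M, 0 <= M & opnorm N N Bo = M%:E.
  apply: opnormNN_fin => //; rewrite ltey; apply/eqP => By.
  by move: normAB; rewrite By gt0_muley // leye_eq.
have [A [bA AE nA]] := extend_bounded linA MA0 hMA.
have [B [bB BE nB]] := extend_bounded linB MB0 hMB.
pose e := compress d mu nu.
exists A, B, e; split.
- by [].
- split.
    apply: le_trans normAB; apply: lee_pmul => //.
      exact: opnorm_ge0Z bA.1.
    exact: opnorm_ge0Z bB.1.
  apply: (eq_dense iota_dense) => [||f].
  + exact: bounded_op_comp.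
  + exact: bounded_op_id.
  + by rewrite /= BE AE AB.
- split; first by apply: bounded_op_comp => //; exact: bounded_op_comp.
  (* [B] spreads the Haar tensor over the digit sets, where [D] acts diagonally; [compression_sum]
     then collects the images under [A]. *)
  move=> I J; rewrite /= BE /Bo opB_haar2 tensor_digits (multiplierE _ linD DE) AE.
  rewrite -linearZ -(compression_sum hmu hnu).
  have linM := haar_mult_linear d.
  rewrite (linear_sumE _ _ _ linM) (linear_sumE _ _ _ linA); congr (iota _).
  apply: eq_bigr => K _; rewrite (linear_sumE _ _ _ linM) (linear_sumE _ _ _ linA).
  apply: eq_bigr => L _; rewrite haar_mult_haar2.
  exact: linearZE.
- split; first exact: (lambda_compress hU tau_0 gnu gmu).
  exact: (mu_compress hU tau_0 gnu gmu).
- have tau6 k : 6 * tau k = eps / 4 / k.+1%:R * 2^-1 ^+ k.+1.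
    by rewrite /tau mulrC divfK.
  have le36 k : 3 * tau k <= 6 * tau k by have := tau_gt0 k; lra.
  have tau0le : tau 0 <= eps / 24 by have := tau_half 0; rewrite expr0 mulr1.
  split.
  + have -> : eps = 4 * (eps / 4) by field.
    apply: T2S_norm_le => [|I J w x IJ|I J w x IJ|I J w JI|I J x j Jj Ij].
    * by rewrite divr_ge0 // ltW.
    * by rewrite -tau6; exact: (compress_diag hU dB tauS gnu gmu).
    * by rewrite -tau6; exact: (compress_subdiag hU dB tauS gnu gmu).
    * by rewrite -tau6 (le_trans _ (le36 _)) //; exact: (compress_left hU dB tauS gmu).
    * rewrite -tau6 (le_trans _ (le36 _)) //.
      apply: le_trans (compress_right hU dB tauS gnu _ _) _; first by rewrite Jj.
      by rewrite Jj; have := tauS j; lra.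
  + by rewrite (le_trans (compress_unit gnu gmu)) //; lra.
  + by move=> x; rewrite (le_trans (compress_unit_child hU dB tauS gnu gmu x)) //; lra.
Unshelve. all: by end_near. Qed.

End CaponSpace.

Section Factorization.
Context {R : realType}.
Variables (C : R) (N : V2 R -> R) (Z : completeNormedModType R).
Variable iota : {linear V2 R -> Z}.
Hypotheses (hN : is_norm N) (hZ : is_completion N iota).
Hypothesis hCapon : capon_space C N iota.

Local Notation nZ := (fun z : Z => `|z|).

Let iota_dense : dense (range iota) := hZ.2.

Lemma linear_scale_sub (V : lmodType R) (S T : V -> V) (a b : R) : linear S -> linear T ->
  linear (fun f => a *: (b *: S f - T f)).
Proof.
move=> linS linT c f g; rewrite linS linT opprD (scalerDr b) addrACA.
by rewrite [b *: (c *: _)]scalerA [b * c]mulrC -scalerA -scalerBr scalerDr !scalerA [a * c]mulrC.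
Qed.

Lemma linear_sub_fun (V W : lmodType R) (S T : V -> W) : linear S -> linear T ->
  linear (fun f => S f - T f).
Proof. by move=> linS linT c f g; rewrite linS linT opprD addrACA -scalerBr. Qed.

Lemma iota_linear : linear iota.
Proof. by move=> c f g; rewrite linearP. Qed.

Lemma iota_capon_comb_linear a b : linear (fun f => iota (capon_comb a b f)).
Proof. exact: linear_comp_fun iota_linear (capon_comb_linear a b). Qed.

Lemma capon_bound : exists2 beta : R, 0 < beta &
  forall (D : Z -> Z) (d : dyadic -> dyadic -> R) (U : set_system nat) (t : R),
    nonprincipal U -> bounded_haar_mult iota D d -> (T2_norm d <= t%:E)%E ->
    forall f, `|D (iota f) - iota (capon_comb (lambdaU U d) (muU U d) f)|
      <= beta * t * `|iota f|.
Proof.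
have [_ [beta beta0 hb]] := hCapon; exists beta => // D d U t hU hD ht.
apply: (opnormN_bound hN hZ).
  have [[linD _] _] := hD.
  exact: linear_sub_fun (linear_comp_fun linD iota_linear) (iota_capon_comb_linear _ _).
apply: le_trans (hb D d U hD hU) _.
by rewrite EFinM; apply: lee_wpmul2l => //; rewrite lee_fin ltW.
Qed.

Lemma capon_comb_bounded (D : Z -> Z) d (U : set_system nat) :
  nonprincipal U -> bounded_haar_mult iota D d ->
  exists S : Z -> Z, bounded_op S /\
    forall f, S (iota f) = iota (capon_comb (lambdaU U d) (muU U d) f).
Proof.
move=> hU hD; have [beta beta0 hb] := capon_bound.
have [A [B [e [_ _ hADB [<- <-] [hT _ _]]]]] :=
  compression_exists hN hZ hCapon hU hD ltr01.
set lm := lambdaU U e; set m := muU U e.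
pose t := 1 + (`|e unit_itv unit_itv| + `|e unit_itv (child true unit_itv)|
    + `|e unit_itv (child false unit_itv)|).
have ht : (T2_norm e <= t%:E)%E by rewrite /T2_norm /t [in leRHS]EFinD leeD2r.
have {ht} hb' := hb _ _ _ _ hU hADB ht.
have [/bounded_opP[linE [K K0 hK]] _] := hADB.
have t0 : 0 <= t by rewrite /t !addr_ge0.
(* On [V2] the norm of S f is at most that of A D B f plus that of A D B f - S f: [K] bounds the
   former, and condition (b) the latter by [beta * t]. *)
have [||S [linS SE Sb]] := extend_dense iota_dense
    (q := fun f => iota (capon_comb lm m f)) (M := K + beta * t) (iota_capon_comb_linear _ _).
- by rewrite addr_ge0 // mulr_ge0 // ltW.
- move=> f; have := hb' f; have := hK (iota f); rewrite -/lm -/m mulrDl.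
  have := ler_normB ((A \o D \o B) (iota f))
    ((A \o D \o B) (iota f) - iota (capon_comb lm m f)).
  rewrite subKr; lra.
exists S; split=> //; apply/bounded_opP; split=> //; exists (K + beta * t) => //.
by rewrite addr_ge0 // mulr_ge0 // ltW.
Qed.

(* The coefficients of the Capon projection are constant within each of the four
   families of differences. *)
Lemma T2S_norm_sub_capon (e : dyadic -> dyadic -> R) a b :
  T2S_norm (fun I J => -1 * capon_coef a b I J + e I J) = T2S_norm e.
Proof.
have dist s (x y : R) : `|-1 * s + x - (-1 * s + y)| = `|x - y|.
  by congr `|_|; ring.
rewrite /T2S_norm; congr (_ + _ + _ + _)%E; apply: eq_eseriesr => k _; congr EFin.
- congr (_ * _); do 4 (apply: eq_bigr => ? _).
  by rewrite /capon_coef /= !leqnn dist.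
- congr (_ * _); do 4 (apply: eq_bigr => ? _).
  by rewrite /capon_coef /= !ltnn dist.
- rewrite big_nat [RHS]big_nat; apply: eq_bigr => j /andP[_ jk].
  have {}jk : (j <= k)%N := jk.
  do 3 (apply: eq_bigr => ? _).
  by rewrite /capon_coef /= jk (leqW jk) dist.
- rewrite big_nat [RHS]big_nat; apply: eq_bigr => i /andP[_ ik].
  do 3 (apply: eq_bigr => ? _).
  by rewrite /capon_coef /= leqNgt ik leqNgt (leqW ik) dist.
Qed.

Lemma capon_comb_factor (D S : Z -> Z) d (U : set_system nat) eta :
  nonprincipal U -> bounded_haar_mult iota D d -> bounded_op S ->
  (forall f, S (iota f) = iota (capon_comb (lambdaU U d) (muU U d) f)) ->
  0 < eta -> proj_factor C eta D S.
Proof.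
move=> hU hD bS SE eta0; have [beta beta0 hb] := capon_bound.
(* The T^2-norm of the difference is at most [4 * eps]: one [eps] for the variation and one for each
   of the three root entries. *)
pose eps := eta / (4 * beta).
have eps0 : 0 < eps by rewrite divr_gt0 // mulr_gt0.
have [A [B [e [[bA bB] [nAB AB] hADB [el em] [hT h0 h1]]]]] :=
  compression_exists hN hZ hCapon hU hD eps0.
exists A, B; split=> //; have [bADB ADBE] := hADB.
have eb := bounded_multiplier_coefs hN hZ hADB.
set lm := lambdaU U d in SE el h0 *; set m := muU U d in SE em h1 *.
pose e' I J := -1 * capon_coef lm m I J + e I J.
have cb := capon_coef_bounded lm m.
have le' : lambdaU U e' = 0.
  by rewrite lambda_linear // (lambda_capon_coef hU) el mulN1r addNr.
have me' : muU U e' = 0.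
  by rewrite mu_linear // (mu_capon_coef hU) em mulN1r addNr.
have hD' : bounded_haar_mult iota (fun z => (A \o D \o B) z - S z) e'.
  split; first exact: bounded_op_sub.
  move=> I J; rewrite ADBE SE capon_comb_haar2 linearZ /e'.
  by rewrite mulN1r -scalerBl addrC.
have hT' : (T2_norm e' <= (4 * eps)%:E)%E.
  have -> : 4 * eps = eps + (eps + eps + eps) by ring.
  rewrite /T2_norm [in leRHS]EFinD; apply: leeD.
    by rewrite T2S_norm_sub_capon.
  rewrite lee_fin /e' /capon_coef /= !mulN1r ![- _ + _]addrC.
  by rewrite lerD ?lerD.
have := hb _ _ _ _ hU hD' hT'; rewrite le' me' => hf.
apply: opnorm_le; first exact: ltW.
apply: (bound_dense iota_dense (T := fun z => S z - A (D (B z)))).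
  exact: bounded_op_sub.
move=> f; rewrite distrC; have := hf f.
have -> : capon_comb 0 0 f = 0 by rewrite /capon_comb !scale0r addr0.
rewrite (linear0 iota) subr0.
have -> // : beta * (4 * eps) = eta by rewrite /eps; field; lra.
Qed.

Lemma capon_comb_scalar (a : R) (S : Z -> Z) : bounded_op S ->
  (forall f, S (iota f) = iota (capon_comb a a f)) -> S = (fun z => a *: z).
Proof.
move=> bS SE; apply: (eq_dense iota_dense) => // [|f].
  have b1 := bounded_op_id (Z := Z); have := bounded_op_lin a b1 (bounded_op_sub b1 b1).
  by congr bounded_op; apply/funext => z; rewrite /= subrr addr0.
by rewrite SE /capon_comb -scalerDr addrC subrK linearZ.
Qed.

(** On [V2] one has (a - b) C = S - b Id, so [a != b] would make the Capon projection bounded. *)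
Lemma unbounded_capon_eq a b (S : Z -> Z) : opnorm N N (@capon R) = +oo%E ->
  bounded_op S -> (forall f, S (iota f) = iota (capon_comb a b f)) -> a = b.
Proof.
move=> Cy /bounded_opP[linS [K K0 hK]] SE; apply/eqP/negP => /negP ab.
have ab0 : 0 < `|a - b| by rewrite normr_gt0 subr_eq0.
suff : (opnorm N N (@capon R) <= ((K + `|b|) / `|a - b|)%:E)%E.
  by rewrite Cy leye_eq.
apply: opnorm_le => [|f]; first by rewrite divr_ge0 // addr_ge0.
rewrite mulrAC ler_pdivlMr // mulrC.
have NE g : N g = `|iota g| by rewrite hZ.1.
have -> : `|a - b| * N (capon f) = `|iota (capon_comb a b f - b *: f)|.
  case: hN => _ <- _; rewrite NE; congr (`|iota _|).
  by rewrite /capon_comb scalerBl scalerBr -addrA addrAC subrr add0r.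
rewrite linearB -SE linearZ /= (le_trans (ler_normB _ _)) // mulrDl !NE.
by rewrite normrZ lerD2r hK.
Qed.

(* S = lambda C + mu (Id - C) satisfies (S - lambda) (S - mu) = 0, so S^-1 is
   ((lambda + mu) - S) / (lambda mu). *)
Lemma factor_identity (D : Z -> Z) d (U : set_system nat) :
  nonprincipal U -> bounded_haar_mult iota D d ->
  lambdaU U d != 0 -> muU U d != 0 -> factors_through id D.
Proof.
move=> hU hD l0 m0; have [S [bS SE]] := capon_comb_bounded hU hD.
set l := lambdaU U d in l0 SE *; set m := muU U d in m0 SE *.
pose S' z := (l * m)^-1 *: ((l + m) *: z - S z).
have bS' : bounded_op S'.
  have b0 := bounded_op_sub (bounded_op_id (Z := Z)) (bounded_op_id (Z := Z)).
  have b1 := bounded_op_lin (l + m) (bounded_op_id (Z := Z)) b0.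
  have := bounded_op_lin (l * m)^-1 (bounded_op_sub b1 bS) b0.
  by congr bounded_op; apply/funext => z; rewrite /= !subrr !addr0.
have S'S : S' \o S = id.
  apply: (eq_dense iota_dense) => [||f].
  - exact: bounded_op_comp.
  - exact: bounded_op_id.
  rewrite /S' /= SE SE capon_comb_comp -linearZ -linearB -linearZ; congr (iota _).
  apply: (eq_linear_haar2 (T := id) (S := fun f =>
    (l * m)^-1 *: ((l + m) *: capon_comb l m f - capon_comb (l * l) (m * m) f))).
  - exact: linear_scale_sub (capon_comb_linear _ _) (capon_comb_linear _ _).
  - by [].
  - move=> I J; rewrite !capon_comb_haar2 /capon_coef.
    rewrite scalerA -scalerBl scalerA.
    have -> : (l * m)^-1 * ((l + m) * (if (level J <= level I)%N then l else m) -
        (if (level J <= level I)%N then l * l else m * m)) = 1.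
      by case: ifP => _; field; rewrite l0 m0.
    by rewrite scale1r.
have [linS' [K K0 hK]] := (bounded_opP S').1 bS'.
(* Chosen so that [K * eta <= 1/2]: then [S'] applied to S - A D B has norm at most 1/2, as the
   Neumann argument requires. *)
pose eta := (2 * (K + 1))^-1.
have eta0 : 0 < eta by rewrite invr_gt0; lra.
have [A [B [bA bB _ _ hAB]]] := capon_comb_factor hU hD bS SE eta0.
have [bD _] := hD.
have bT : bounded_op (S' \o (A \o (D \o B))).
  by apply: bounded_op_comp => //; apply: bounded_op_comp => //; exact: bounded_op_comp.
have [|T' bT' T'T] := near_id_invertible bT.
  move=> z.
  have -> : z - (S' \o (A \o (D \o B))) z = S' (S z - A (D (B z))).
    rewrite -{1}[z]/(id z) -S'S /=.
    by rewrite (linearBE _ _ linS').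
  apply: le_trans (hK _) _.
  have linE : linear (fun z => S z - A (D (B z))).
    have bADB := bounded_op_sub bS (bounded_op_comp bA (bounded_op_comp bD bB)).
    exact: bADB.1.
  have h := opnorm_boundZ linE hAB z.
  apply: (le_trans (ler_wpM2l K0 h)); rewrite mulrA ler_wpM2r //.
  rewrite /eta invfM mulrCA ler_piMr // ler_pdivrMr; lra.
(* A left inverse of S' A D B suffices: the left factor is T' S' A, the right one B. *)
exists (T' \o (S' \o A)), B; split=> //.
by apply: bounded_op_comp => //; exact: bounded_op_comp.
Qed.

Lemma compl_multiplier (D : Z -> Z) d : bounded_haar_mult iota D d ->
  bounded_haar_mult iota (fun z => z - D z) (fun I J => -1 * d I J + 1).
Proof.
move=> [bD DE]; split; first exact: bounded_op_sub (bounded_op_id (Z := Z)) bD.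
by move=> I J; rewrite DE scalerDl scale1r mulN1r scaleNr addrC.
Qed.

End Factorization.

Theorem theorem2p32 (R : realType) (C : R) (N : V2 R -> R)
    (Z : completeNormedModType R) (iota : {linear V2 R -> Z})
    (hC : 0 < C) (hN : is_norm N) (hZ : is_completion N iota)
    (hCapon : capon_space C N iota) :
  [/\ forall (D : Z -> Z) (d : dyadic -> dyadic -> R) (U : set_system nat),
        bounded_haar_mult iota D d -> nonprincipal U ->
        exists S : Z -> Z,
          [/\ bounded_op S,
              forall f, S (iota f) = iota (capon_comb (lambdaU U d) (muU U d) f)
            & forall eta : R, 0 < eta -> proj_factor C eta D S],
      opnorm N N (@capon R) = +oo%E ->
        forall (D : Z -> Z) (d : dyadic -> dyadic -> R) (U : set_system nat),
          bounded_haar_mult iota D d -> nonprincipal U ->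
          lambdaU U d = muU U d /\
          forall eta : R, 0 < eta ->
            proj_factor C eta D (fun z => lambdaU U d *: z)
    & forall (D : Z -> Z) (d : dyadic -> dyadic -> R),
        bounded_haar_mult iota D d ->
        (exists2 U : set_system nat, nonprincipal U &
          (lambdaU U d, muU U d) <> (1, 0) /\ (lambdaU U d, muU U d) <> (0, 1)) ->
        factors_through id D \/ factors_through id (fun z => z - D z)].

Proof.
split.
- move=> D d U hD hU; have [S [bS SE]] := capon_comb_bounded hN hZ hCapon hU hD.
  exists S; split=> // eta; exact: (capon_comb_factor hN hZ hCapon hU hD).
- move=> Cy D d U hD hU; have [S [bS SE]] := capon_comb_bounded hN hZ hCapon hU hD.
  have lm := unbounded_capon_eq hN hZ Cy bS SE.
  split=> // eta eta0; have SE' := SE; rewrite -lm in SE'.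
  rewrite -(capon_comb_scalar hZ bS SE').
  exact: (capon_comb_factor hN hZ hCapon hU hD).
- move=> D d hD [U hU [h10 h01]].
  have hD' := compl_multiplier hD.
  have one_b : bounded_coefs (fun _ _ => 1 : R) by exists `|1| => I J.
  have db := bounded_multiplier_coefs hN hZ hD.
  have l1 : lambdaU U (fun I J => -1 * d I J + 1) = 1 - lambdaU U d.
    have one_l : lambdaU U (fun _ _ => 1 : R) = 1 by exact: lambda_eventually.
    by rewrite (lambda_linear hU _ db one_b) one_l mulN1r addrC.
  have m1 : muU U (fun I J => -1 * d I J + 1) = 1 - muU U d.
    have one_m : muU U (fun _ _ => 1 : R) = 1 by exact: mu_eventually.
    by rewrite (mu_linear hU _ db one_b) one_m mulN1r addrC.
  have F := factor_identity hN hZ hCapon hU hD.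
  have F' := factor_identity hN hZ hCapon hU hD'; rewrite l1 m1 !subr_eq0 in F'.
  (* The functionals of Id - D are 1 - lambda and 1 - mu. If one of lambda, mu is 0, the excluded
     pairs (0, 1) and (1, 0) are exactly those for which the other equals 1. *)
  have [l0|l0] := eqVneq (lambdaU U d) 0; have [m0|m0] := eqVneq (muU U d) 0.
  + by right; apply: F'; rewrite ?l0 ?m0 oner_neq0.
  + right; apply: F'; rewrite ?l0 ?oner_neq0 //.
    by apply/eqP => mE; apply: h01; rewrite l0 -mE.
  + right; apply: F'; rewrite ?m0 ?oner_neq0 //.
    by apply/eqP => lE; apply: h10; rewrite m0 -lE.
  + by left; apply: F.
Qed.
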